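(* Let $\Bbbk$ be an algebraically closed field, let $n\ge 2$, let $Q$ be the quiver $1\to 2\to\cdots\to n$, and let $\Lambda=\Bbbk Q$. Let $\chi$ and $\chi'$ be complete exceptional collections in mod-$\Lambda$, with Hom-Ext quivers with relations $(Q^\chi,R^\chi)$ and $(Q^{\chi'},R^{\chi'})$ and associated non-crossing spanning trees $T(\chi)$ and $T(\chi')$ of the $(n+1)$-gon. Then $$(Q^\chi,R^\chi)\cong (Q^{\chi'},R^{\chi'})$$ if and only if $T(\chi')=\sigma^m(T(\chi))$ for some cyclic rotation $\sigma^m$ of the $(n+1)$-gon.
   Context: mod-$\Lambda$ is the category of finitely generated $\Lambda$-modules, and $\mathrm{Ext}=\mathrm{Ext}^1_\Lambda$; modules are considered up to isomorphism. The indecomposable $\Lambda$-modules are the interval modules $X_{i,j}$, $0\le i<j\le n$: $X_{i,j}$ assigns $\Bbbk$ to each vertex $k$ with $i<k\le j$, $0$ to all other vertices, and the identity to each arrow between two nonzero vertices. Exceptional collections. An indecomposable $\Lambda$-module $E$ is exceptional if $\mathrm{Ext}(E,E)=0$. A sequence of exceptional modules $(E_1,\dots,E_k)$ is an exceptional sequence if $\mathrm{Hom}(E_i,E_j)=0=\mathrm{Ext}(E_i,E_j)$ for all $i>j$; it is complete if $k=n$. A complete exceptional collection is an unordered set of modules that can be ordered into a complete exceptional sequence in at least one way. Hom-Ext quiver. For a complete exceptional collection $\chi=\{E_1,\dots,E_n\}$, let $A_\chi=\bigoplus_{i,j}\big(\mathrm{Hom}(E_i,E_j)\oplus\mathrm{Ext}^1(E_i,E_j)\big)$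 be its Yoneda Ext algebra (products landing in $\mathrm{Ext}^{2}=0$ are zero). The Hom-Ext quiver with relations $(Q^\chi,R^\chi)$ is the quiver with relations of $A_\chi$, with the grading forgotten: the vertices are $E_1,\dots,E_n$; the number of arrows $E_i\to E_j$ is the dimension of the component of $\mathrm{rad}(A_\chi)/\mathrm{rad}^2(A_\chi)$ coming from $\mathrm{Hom}(E_i,E_j)\oplus\mathrm{Ext}^1(E_i,E_j)$; and $R^\chi$ is the ideal of relations, i.e. the kernel of the surjection $\Bbbk Q^\chi\to A_\chi$ obtained by lifting arrows to classes. (In type $A$ each space $\mathrm{Hom}(E_i,E_j)\oplus\mathrm{Ext}^1(E_i,E_j)$ has dimension at most one, so lifts are unique up to scalar.) An isomorphism of quivers with relations is an isomorphism of the underlying ungraded quivers carrying one ideal of relations onto the other. Trees. The regular $(n+1)$-gon has vertices labeled $0,1,\dots,n$ in cyclic order (identified with $\mathbb{Z}/(n+1)\mathbb{Z}$). A chord is a segment joining two distinct vertices (sides of the polygon are allowed); $c_{i,j}$ denotes the chord joining $i$ and $j$. A non-crossing spanning tree is a set of $n$ chords forming a spanning tree of $\{0,\dots,n\}$, no two of which cross in the interior of the polygon. For a complete exceptional collection $\chi$, $T(\chi)=\{c_{i,j}: X_{i,j}\in\chi\}$, which is a non-crossing spanning tree by a theorem of Araya; $\chi\mapsto T(\chi)$ is a bijection from complete exceptional collections to non-crossing spanning trees. $\sigma$ is the rotation $k\mapsto k+1 \pmod{n+1}$ acting on chords and on sets of chords. *)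

(* Defs.v *)
From HB Require Import structures.
From mathcomp Require Import all_boot all_fingroup all_algebra.
From mathcomp Require Import finmap boolp.
From mathcomp.multinomials Require Import monalg.

Set Implicit Arguments.
Unset Strict Implicit.
Unset Printing Implicit Defensive.

Import GRing.Theory.
Local Open Scope ring_scope.
Local Open Scope quotient_scope.

Section DffunZmod.
Variables (aT : finType) (rT : aT -> zmodType).
Implicit Types f g : {dffun forall a, rT a}.

Definition dffun_zero : {dffun forall a, rT a} := [ffun a => 0].
Definition dffun_opp f : {dffun forall a, rT a} := [ffun a => - f a].
Definition dffun_add f g : {dffun forall a, rT a} := [ffun a => f a + g a].

Fact dffun_addA : associative dffun_add.
Proof. by move=> f g h; apply/ffunP=> a; rewrite !ffunE addrA. Qed.
Fact dffun_addC : commutative dffun_add.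
Proof. by move=> f g; apply/ffunP=> a; rewrite !ffunE addrC. Qed.
Fact dffun_add0 : left_id dffun_zero dffun_add.
Proof. by move=> f; apply/ffunP=> a; rewrite !ffunE add0r. Qed.
Fact dffun_addN : left_inverse dffun_zero dffun_opp dffun_add.
Proof. by move=> f; apply/ffunP=> a; rewrite !ffunE addNr. Qed.

HB.instance Definition _ := GRing.isZmodule.Build {dffun forall a, rT a}
  dffun_addA dffun_addC dffun_add0 dffun_addN.

Lemma dffun0E a : (0 : {dffun forall a, rT a}) a = 0.
Proof. by rewrite ffunE. Qed.
Lemma dffunDE f g a : (f + g) a = f a + g a.
Proof. by rewrite ffunE. Qed.
Lemma dffunNE f a : (- f) a = - f a.
Proof. by rewrite ffunE. Qed.
Lemma dffun_sumE I (r : seq I) (P : pred I) (F : I -> {dffun forall a, rT a}) a :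
  (\sum_(i <- r | P i) F i) a = \sum_(i <- r | P i) F i a.
Proof. by elim/big_rec2: _ => [|i y1 y2 _ <-]; rewrite ?dffun0E ?dffunDE. Qed.
End DffunZmod.

Section DffunLmod.
Variables (k : pzRingType) (aT : finType) (rT : aT -> lmodType k).
Implicit Types f g : {dffun forall a, rT a}.

Definition dffun_scale (c : k) f : {dffun forall a, rT a} := [ffun a => c *: f a].

Fact dffun_scaleA c d f :
  dffun_scale c (dffun_scale d f) = dffun_scale (c * d) f.
Proof. by apply/ffunP=> a; rewrite !ffunE scalerA. Qed.
Fact dffun_scale1 : left_id 1 dffun_scale.
Proof. by move=> f; apply/ffunP=> a; rewrite !ffunE scale1r. Qed.
Fact dffun_scaleDr : right_distributive dffun_scale +%R.
Proof. by move=> c f g; apply/ffunP=> a; rewrite !ffunE scalerDr. Qed.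
Fact dffun_scaleDl f : {morph dffun_scale^~ f : c d / c + d}.
Proof. by move=> c d; apply/ffunP=> a; rewrite !ffunE scalerDl. Qed.

HB.instance Definition _ := GRing.Zmodule_isLmodule.Build k
  {dffun forall a, rT a} dffun_scaleA dffun_scale1 dffun_scaleDr dffun_scaleDl.

Lemma dffunZE c f a : (c *: f) a = c *: f a.
Proof. by rewrite ffunE. Qed.
End DffunLmod.

Record quiver (V : finType) := Quiver {
  arr : finType;
  src : arr -> V;
  tgt : arr -> V }.

Arguments src {V q} _.
Arguments tgt {V q} _.

Section Representations.
Variables (k : fieldType) (V : finType) (Q : quiver V).

(* A finite-dimensional module over the path algebra of [Q], given as a
   representation of [Q]. Matrices act on row vectors from the right, so that [f *m g] is
   "f followed by g"; all composition products below use this order. *)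
Record rep := Rep {
  rdim : V -> nat;
  rmap : forall a : arr Q, 'M[k]_(rdim (src a), rdim (tgt a)) }.

Section Complex.
Variables M N : rep.

Definition cochain0 := {dffun forall v : V, 'M[k]_(rdim M v, rdim N v)}.
Definition cochain1 :=
  {dffun forall a : arr Q, 'M[k]_(rdim M (src a), rdim N (tgt a))}.

HB.instance Definition _ := GRing.Lmodule.on cochain0.
HB.instance Definition _ := GRing.Lmodule.on cochain1.

(* The standard projective resolution of [M] over the path algebra,
     0 -> (+)_a P_(tgt a) (x) M_(src a) -> (+)_v P_v (x) M_v -> M -> 0,
   becomes, under Hom(-, N), the two-term complex
   [diff : cochain0 -> cochain1], with cohomology Hom(M, N) and Ext^1(M, N). *)
Definition diff (f : cochain0) : cochain1 :=
  [ffun a => f (src a) *m rmap N a - rmap M a *m f (tgt a)].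

Fact diff_is_linear : linear diff.
Proof.
move=> c f g; apply/ffunP=> a; rewrite dffunDE dffunZE !ffunE.
rewrite mulmxDl mulmxDr -scalemxAl -scalemxAr scalerBr opprD !addrA.
by congr (_ + _); rewrite addrAC.
Qed.
HB.instance Definition _ := GRing.isLinear.Build k cochain0 cochain1 _ diff
  diff_is_linear.

Definition is_hom : {pred cochain0} := [pred f | diff f == 0].
Definition is_coboundary : {pred cochain1} := [pred e | `[< exists f, e = diff f >]].

Fact is_hom_submod : submod_closed is_hom.
Proof.
split=> [|c f g]; first by rewrite inE linear0.
rewrite !inE => /eqP df0 /eqP dg0; apply/eqP.
by rewrite linearP /= df0 dg0 scaler0 addr0.
Qed.
HB.instance Definition _ := GRing.isSubmodClosed.Build k cochain0 is_hom is_hom_submod.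

Lemma is_coboundaryP e : reflect (exists f, e = diff f) (e \in is_coboundary).
Proof. exact: asboolP. Qed.

Fact is_coboundary_submod : submod_closed is_coboundary.
Proof.
split=> [|c e e']; first by apply/is_coboundaryP; exists 0; rewrite linear0.
move=> /is_coboundaryP[f def_e] /is_coboundaryP[g def_e'].
by apply/is_coboundaryP; exists (c *: f + g); rewrite linearP def_e def_e'.
Qed.
HB.instance Definition _ := GRing.isSubmodClosed.Build k cochain1 is_coboundary
  is_coboundary_submod.

Definition hom := {f : cochain0 | f \in is_hom}.
HB.instance Definition _ := Choice.on hom.
HB.instance Definition _ := SubType.on hom.
HB.instance Definition _ := [SubChoice_isSubLmodule of hom by <:].

Definition ext := Quotient.quot is_coboundary.
HB.instance Definition _ := GRing.Zmodule.on ext.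
HB.instance Definition _ := EqQuotient.on ext.

Definition ext_class (e : cochain1) : ext := \pi_ext e.
Definition ext_repr (x : ext) : cochain1 := generic_quotient.repr x.

Lemma ext_reprK : cancel ext_repr ext_class.
Proof. exact: generic_quotient.reprK. Qed.

Lemma ext_classP e e' :
  ext_class e = ext_class e' <-> exists f, e = e' + diff f.
Proof.
split=> [/eqP|[f ->]].
  rewrite /ext_class -Quotient.idealrBE => /is_coboundaryP[f def_f].
  by exists f; rewrite -def_f addrC subrK.
apply/eqP; rewrite /ext_class -Quotient.idealrBE addrAC subrr add0r.
by apply/is_coboundaryP; exists f.
Qed.

Fact ext_class_is_zmod_morphism : zmod_morphism ext_class.
Proof. by move=> e e'; rewrite /ext_class !piE. Qed.
HB.instance Definition _ := GRing.isZmodMorphism.Build cochain1 ext ext_class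
  ext_class_is_zmod_morphism.

Definition ext_scale (c : k) (x : ext) : ext := ext_class (c *: ext_repr x).

Lemma ext_scaleE c e : ext_scale c (ext_class e) = ext_class (c *: e).
Proof.
apply/ext_classP; have /ext_classP[f ->] := ext_reprK (ext_class e).
by exists (c *: f); rewrite linearZ scalerDr.
Qed.

Fact ext_scaleA c d x : ext_scale c (ext_scale d x) = ext_scale (c * d) x.
Proof. by rewrite /ext_scale -/(ext_scale _ _) ext_scaleE scalerA. Qed.
Fact ext_scale1 : left_id 1 ext_scale.
Proof. by move=> x; rewrite /ext_scale scale1r ext_reprK. Qed.
Fact ext_scaleDr : right_distributive ext_scale +%R.
Proof.
move=> c x y; rewrite -[x]ext_reprK -[y]ext_reprK -raddfD !ext_scaleE.
by rewrite scalerDr raddfD.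
Qed.
Fact ext_scaleDl x : {morph ext_scale^~ x : c d / c + d}.
Proof. by move=> c d; rewrite /ext_scale scalerDl raddfD. Qed.
HB.instance Definition _ := GRing.Zmodule_isLmodule.Build k ext
  ext_scaleA ext_scale1 ext_scaleDr ext_scaleDl.

Fact ext_class_is_scalable : scalable ext_class.
Proof. by move=> c e; rewrite -ext_scaleE. Qed.
HB.instance Definition _ := GRing.isScalable.Build k cochain1 ext _ ext_class
  ext_class_is_scalable.
End Complex.

Lemma homP (M N : rep) (f : hom M N) (a : arr Q) :
  sval f (src a) *m rmap N a = rmap M a *m sval f (tgt a).
Proof.
have := valP f; rewrite inE => /eqP/ffunP/(_ a).
by rewrite dffun0E ffunE => /eqP; rewrite subr_eq0 => /eqP.
Qed.

Section Products.
Variables L M N : rep.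

Definition comp0 (f : cochain0 L M) (g : cochain0 M N) : cochain0 L N :=
  [ffun v => f v *m g v].

Fact comp_is_hom (f : hom L M) (g : hom M N) : comp0 (sval f) (sval g) \in @is_hom L N.
Proof.
rewrite inE; apply/eqP/ffunP=> a; rewrite dffun0E !ffunE.
by rewrite -mulmxA homP mulmxA homP mulmxA subrr.
Qed.
Definition hom_comp (f : hom L M) (g : hom M N) : hom L N :=
  exist (fun h => h \in @is_hom L N) (comp0 (sval f) (sval g)) (comp_is_hom f g).

(* Pullback of an extension along [f], pushout along [g]. *)
Definition pull0 (f : cochain0 L M) (e : cochain1 M N) : cochain1 L N :=
  [ffun a => f (src a) *m e a].
Definition push0 (e : cochain1 L M) (g : cochain0 M N) : cochain1 L N :=
  [ffun a => e a *m g (tgt a)].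
Definition ext_pull (f : hom L M) (x : ext M N) : ext L N :=
  ext_class (pull0 (sval f) (ext_repr x)).
Definition ext_push (x : ext L M) (g : hom M N) : ext L N :=
  ext_class (push0 (ext_repr x) (sval g)).

Lemma ext_pullE (f : hom L M) e :
  ext_pull f (ext_class e) = ext_class (pull0 (sval f) e).
Proof.
apply/ext_classP; have /ext_classP[h ->] := ext_reprK (ext_class e).
exists (comp0 (sval f) h); apply/ffunP=> a; rewrite !(dffunDE, ffunE) mulmxDr.
by rewrite mulmxBr !mulmxA homP.
Qed.

Lemma ext_pushE e (g : hom M N) :
  ext_push (ext_class e) g = ext_class (push0 e (sval g)).
Proof.
apply/ext_classP; have /ext_classP[h ->] := ext_reprK (ext_class e).
exists (comp0 h (sval g)); apply/ffunP=> a; rewrite !(dffunDE, ffunE) mulmxDl.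
by rewrite mulmxBl -!mulmxA homP.
Qed.
End Products.

Section ProductTheory.
Variables K L M N : rep.

Lemma hom_compDl (f f' : hom L M) (g : hom M N) :
  hom_comp (f + f') g = hom_comp f g + hom_comp f' g.
Proof. by apply/val_inj/ffunP=> v; rewrite !(dffunDE, ffunE) mulmxDl. Qed.
Lemma hom_compDr (f : hom L M) (g g' : hom M N) :
  hom_comp f (g + g') = hom_comp f g + hom_comp f g'.
Proof. by apply/val_inj/ffunP=> v; rewrite !(dffunDE, ffunE) mulmxDr. Qed.
Lemma hom_compZl c (f : hom L M) (g : hom M N) :
  hom_comp (c *: f) g = c *: hom_comp f g.
Proof. by apply/val_inj/ffunP=> v; rewrite !(dffunZE, ffunE) scalemxAl. Qed.
Lemma hom_compZr c (f : hom L M) (g : hom M N) :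
  hom_comp f (c *: g) = c *: hom_comp f g.
Proof. by apply/val_inj/ffunP=> v; rewrite !(dffunZE, ffunE) scalemxAr. Qed.
Lemma hom_compA (f : hom K L) (g : hom L M) (h : hom M N) :
  hom_comp f (hom_comp g h) = hom_comp (hom_comp f g) h.
Proof. by apply/val_inj/ffunP=> v; rewrite !ffunE mulmxA. Qed.

Lemma ext_pullDl (f f' : hom L M) (x : ext M N) :
  ext_pull (f + f') x = ext_pull f x + ext_pull f' x.
Proof.
rewrite -[x]ext_reprK !ext_pullE -raddfD; congr (ext_class _).
by apply/ffunP=> a; rewrite !(dffunDE, ffunE) mulmxDl.
Qed.
Lemma ext_pullDr (f : hom L M) (x x' : ext M N) :
  ext_pull f (x + x') = ext_pull f x + ext_pull f x'.
Proof.
rewrite -[x]ext_reprK -[x']ext_reprK -raddfD !ext_pullE -raddfD.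
by congr (ext_class _); apply/ffunP=> a; rewrite !(dffunDE, ffunE) mulmxDr.
Qed.
Lemma ext_pullZl c (f : hom L M) (x : ext M N) :
  ext_pull (c *: f) x = c *: ext_pull f x.
Proof.
rewrite -[x]ext_reprK !ext_pullE -linearZ; congr (ext_class _).
by apply/ffunP=> a; rewrite !(dffunZE, ffunE) scalemxAl.
Qed.
Lemma ext_pullZr c (f : hom L M) (x : ext M N) :
  ext_pull f (c *: x) = c *: ext_pull f x.
Proof.
rewrite -[x]ext_reprK -linearZ !ext_pullE -linearZ; congr (ext_class _).
by apply/ffunP=> a; rewrite !(dffunZE, ffunE) scalemxAr.
Qed.
Lemma ext_pushDl (x x' : ext L M) (g : hom M N) :
  ext_push (x + x') g = ext_push x g + ext_push x' g.
Proof.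
rewrite -[x]ext_reprK -[x']ext_reprK -raddfD !ext_pushE -raddfD.
by congr (ext_class _); apply/ffunP=> a; rewrite !(dffunDE, ffunE) mulmxDl.
Qed.
Lemma ext_pushDr (x : ext L M) (g g' : hom M N) :
  ext_push x (g + g') = ext_push x g + ext_push x g'.
Proof.
rewrite -[x]ext_reprK !ext_pushE -raddfD; congr (ext_class _).
by apply/ffunP=> a; rewrite !(dffunDE, ffunE) mulmxDr.
Qed.
Lemma ext_pushZl c (x : ext L M) (g : hom M N) :
  ext_push (c *: x) g = c *: ext_push x g.
Proof.
rewrite -[x]ext_reprK -linearZ !ext_pushE -linearZ; congr (ext_class _).
by apply/ffunP=> a; rewrite !(dffunZE, ffunE) scalemxAl.
Qed.
Lemma ext_pushZr c (x : ext L M) (g : hom M N) :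
  ext_push x (c *: g) = c *: ext_push x g.
Proof.
rewrite -[x]ext_reprK !ext_pushE -linearZ; congr (ext_class _).
by apply/ffunP=> a; rewrite !(dffunZE, ffunE) scalemxAr.
Qed.

Lemma ext_pullA (f : hom K L) (g : hom L M) (x : ext M N) :
  ext_pull f (ext_pull g x) = ext_pull (hom_comp f g) x.
Proof.
rewrite -[x]ext_reprK !ext_pullE; congr (ext_class _).
by apply/ffunP=> a; rewrite !ffunE mulmxA.
Qed.
Lemma ext_pull_push (f : hom K L) (x : ext L M) (g : hom M N) :
  ext_pull f (ext_push x g) = ext_push (ext_pull f x) g.
Proof.
rewrite -[x]ext_reprK !(ext_pushE, ext_pullE); congr (ext_class _).
by apply/ffunP=> a; rewrite !ffunE mulmxA.
Qed.
Lemma ext_pushA (x : ext K L) (f : hom L M) (g : hom M N) :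
  ext_push (ext_push x f) g = ext_push x (hom_comp f g).
Proof.
rewrite -[x]ext_reprK !ext_pushE; congr (ext_class _).
by apply/ffunP=> a; rewrite !ffunE mulmxA.
Qed.
End ProductTheory.

Section Identity.
Variable M : rep.

Definition id0 : cochain0 M M := [ffun v => 1%:M].
Fact id_is_hom : id0 \in @is_hom M M.
Proof.
rewrite inE; apply/eqP/ffunP=> a.
by rewrite dffun0E !ffunE mul1mx mulmx1 subrr.
Qed.
Definition hom_id : hom M M := exist (fun h => h \in @is_hom M M) id0 id_is_hom.
End Identity.

Lemma hom_comp1l M N (f : hom M N) : hom_comp (hom_id M) f = f.
Proof. by apply/val_inj/ffunP=> v; rewrite !ffunE mul1mx. Qed.
Lemma hom_comp1r M N (f : hom M N) : hom_comp f (hom_id N) = f.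
Proof. by apply/val_inj/ffunP=> v; rewrite !ffunE mulmx1. Qed.
Lemma ext_pull1 M N (x : ext M N) : ext_pull (hom_id M) x = x.
Proof.
rewrite -[x]ext_reprK ext_pullE; congr (ext_class _).
by apply/ffunP=> a; rewrite !ffunE mul1mx.
Qed.
Lemma ext_push1 M N (x : ext M N) : ext_push x (hom_id N) = x.
Proof.
rewrite -[x]ext_reprK ext_pushE; congr (ext_class _).
by apply/ffunP=> a; rewrite !ffunE mulmx1.
Qed.

Definition rep_iso (M N : rep) : Prop :=
  exists (f : hom M N) (g : hom N M),
    hom_comp f g = hom_id M /\ hom_comp g f = hom_id N.

Definition rep_sum (M N : rep) : rep :=
  @Rep (fun v => (rdim M v + rdim N v)%N)
       (fun a => block_mx (rmap M a) 0 0 (rmap N a)).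

Definition rep_zero (M : rep) : Prop := forall v, rdim M v = 0%N.

Definition indecomposable (M : rep) : Prop :=
  ~ rep_zero M /\
  forall A B : rep, rep_iso M (rep_sum A B) -> rep_zero A \/ rep_zero B.

Definition exceptional (M : rep) : Prop :=
  indecomposable M /\ forall x : ext M M, x = 0.

Definition exceptional_sequence (r : nat) (E : 'I_r -> rep) : Prop :=
  (forall i, exceptional (E i)) /\
  forall i j : 'I_r, (j < i)%N ->
    (forall f : hom (E i) (E j), f = 0) /\ (forall x : ext (E i) (E j), x = 0).

(* [ses_cocycle] and [ses_equivP] identify [ext M N] with the equivalence classes
   of short exact sequences 0 -> N -> E -> M -> 0, and [ext_pull_square] and
   [ext_push_square] identify [ext_pull] and [ext_push] with pullback and pushout
   of such sequences, that is, with the Yoneda products. *)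

Definition short_exact (N E M : rep) (i : hom N E) (p : hom E M) : Prop :=
  forall v, [/\ row_free (sval i v), row_full (sval p v) &
                (sval i v :=: kermx (sval p v))%MS].

(* Middle term of the extension 0 -> N -> E -> M -> 0 attached to a cocycle. *)
Definition ext_rep M N (e : cochain1 M N) : rep :=
  @Rep (fun v => (rdim N v + rdim M v)%N)
       (fun a => block_mx (rmap N a) 0 (e a) (rmap M a)).

Section Yoneda.
Variables (M N : rep) (e : cochain1 M N).

Definition ext_in0 : cochain0 N (ext_rep e) := [ffun v => row_mx 1%:M 0].
Definition ext_out0 : cochain0 (ext_rep e) M := [ffun v => col_mx 0 1%:M].

Fact ext_in_is_hom : ext_in0 \in @is_hom N (ext_rep e).
Proof.
rewrite inE; apply/eqP/ffunP=> a; rewrite dffun0E !ffunE /=.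
rewrite mul_row_block mul_mx_row !mul1mx !mul0mx !mulmx1 !mulmx0 !addr0.
by rewrite subrr.
Qed.
Fact ext_out_is_hom : ext_out0 \in @is_hom (ext_rep e) M.
Proof.
rewrite inE; apply/eqP/ffunP=> a; rewrite dffun0E !ffunE /=.
rewrite mul_block_col mul_col_mx !mul1mx !mul0mx !mulmx1 !mulmx0 !add0r.
by rewrite subrr.
Qed.
Definition ext_in : hom N (ext_rep e) :=
  exist (fun h => h \in @is_hom N (ext_rep e)) ext_in0 ext_in_is_hom.
Definition ext_out : hom (ext_rep e) M :=
  exist (fun h => h \in @is_hom (ext_rep e) M) ext_out0 ext_out_is_hom.

Lemma ext_rep_exact : short_exact ext_in ext_out.
Proof.
move=> v; rewrite !ffunE; split.
- by apply/row_freeP; exists (col_mx 1%:M 0); rewrite mul_row_col mul1mx mul0mx addr0.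
- by apply/row_fullP; exists (row_mx 0 1%:M); rewrite mul_row_col mul1mx mul0mx add0r.
apply/eqmxP/andP; split.
  by apply/sub_kermxP; rewrite mul_row_col mulmx0 mul0mx addr0.
set X := kermx _.
have: X *m col_mx 0 1%:M = 0 by apply: mulmx_ker.
rewrite -[X]hsubmxK mul_row_col mulmx0 mulmx1 add0r => ->.
by apply/submxP; exists (lsubmx X); rewrite mul_mx_row mulmx1 mulmx0.
Qed.
End Yoneda.

Definition ses_equiv N M E (i : hom N E) (p : hom E M)
    E' (i' : hom N E') (p' : hom E' M) : Prop :=
  exists h : hom E E', hom_comp i h = i' /\ hom_comp h p' = p.

Lemma ses_cocycle N M E (i : hom N E) (p : hom E M) :
  short_exact i p -> exists e, ses_equiv (ext_in e) (ext_out e) i p.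
Proof.
move=> ex; pose s v := pinvmx (sval p v).
have sK v : s v *m sval p v = 1%:M.
  by case: (ex v) => _ full _; rewrite /s -[pinvmx _]mul1mx mulmxKpV ?submx_full.
have ip0 v : sval i v *m sval p v = 0.
  by case: (ex v) => _ _ eq_ik; apply/sub_kermxP; rewrite eq_ik.
pose e : cochain1 M N := [ffun a =>
  (s (src a) *m rmap E a - rmap M a *m s (tgt a)) *m pinvmx (sval i (tgt a))].
pose h0 : cochain0 (ext_rep e) E := [ffun v => col_mx (sval i v) (s v)].
have h_hom : h0 \in @is_hom (ext_rep e) E.
  rewrite inE; apply/eqP/ffunP=> a; rewrite dffun0E !ffunE /=.
  rewrite mul_block_col mul_col_mx mul0mx addr0 -(homP i) ffunE mulmxKpV ?subrK ?subrr //.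
  case: (ex (tgt a)) => _ _ ->; apply/sub_kermxP.
  rewrite mulmxBl -(mulmxA _ (rmap E a)) -(homP p) mulmxA -(mulmxA (rmap M a)).
  by rewrite !sK mulmx1 mul1mx subrr.
exists e, (exist (fun h => h \in @is_hom (ext_rep e) E) h0 h_hom).
split; apply/val_inj/ffunP=> v; rewrite !ffunE.
  by rewrite mul_row_col mul1mx mul0mx addr0.
by rewrite mul_col_mx sK ip0.
Qed.

Lemma ses_equivP N M (e e' : cochain1 M N) :
  ses_equiv (ext_in e) (ext_out e) (ext_in e') (ext_out e') <->
  ext_class e = ext_class e'.
Proof.
split=> [[h [ih hp]]|/ext_classP[u ->]]; last first.
  pose h0 : cochain0 (ext_rep (e' + diff u)) (ext_rep e') :=
    [ffun v => block_mx 1%:M 0 (u v) 1%:M].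
  have h_hom : h0 \in @is_hom (ext_rep (e' + diff u)) (ext_rep e').
    rewrite inE; apply/eqP/ffunP=> a; rewrite dffun0E !ffunE /=.
    rewrite !mulmx_block !(mul1mx, mulmx1, mul0mx, mulmx0, addr0, add0r).
    rewrite dffunDE ffunE; apply/eqP; rewrite subr_eq0; apply/eqP.
    by congr block_mx; rewrite -addrA subrK addrC.
  exists (exist (fun h => h \in @is_hom _ (ext_rep e')) h0 h_hom).
  split; apply/val_inj/ffunP=> v; rewrite !ffunE.
    by rewrite mul_row_block !(mul1mx, mul0mx, addr0).
  by rewrite mul_block_col !(mulmx1, mulmx0, add0r).
have hE v : sval h v = block_mx 1%:M 0 (dlsubmx (sval h v)) 1%:M.
  have := congr1 (fun f : hom N _ => sval f v) ih.
  have := congr1 (fun f : hom _ M => sval f v) hp.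
  rewrite !ffunE /= -[sval h v]submxK mul_block_col mul_row_block.
  rewrite !(mul1mx, mulmx1, mul0mx, mulmx0, addr0, add0r) block_mxKdl.
  by move=> /eq_col_mx[-> ->] /eq_row_mx[-> _].
apply/ext_classP; exists [ffun v => dlsubmx (sval h v)].
apply/ffunP=> a; rewrite dffunDE !ffunE.
have := homP h a; rewrite hE [sval h (tgt a)]hE /= !mulmx_block.
rewrite !(mul1mx, mulmx1, mul0mx, mulmx0, addr0, add0r).
by move=> /eq_block_mx[_ _ eq_a _]; rewrite !block_mxKdl addrA (addrC (e' a)) eq_a addrK.
Qed.

Lemma ext_pull_square L M N (f : hom L M) (e : cochain1 M N) :
  exists h : hom (ext_rep (pull0 (sval f) e)) (ext_rep e),
    hom_comp (ext_in _) h = ext_in e /\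
    hom_comp h (ext_out e) = hom_comp (ext_out _) f.
Proof.
pose E := ext_rep (pull0 (sval f) e).
pose h0 : cochain0 E (ext_rep e) := [ffun v => block_mx 1%:M 0 0 (sval f v)].
have h_hom : h0 \in @is_hom E (ext_rep e).
  rewrite inE; apply/eqP/ffunP=> a; rewrite dffun0E !ffunE /= !mulmx_block !ffunE.
  by rewrite !(mul1mx, mulmx1, mul0mx, mulmx0, addr0, add0r) homP subrr.
exists (exist (fun h => h \in @is_hom E (ext_rep e)) h0 h_hom).
split; apply/val_inj/ffunP=> v; rewrite !ffunE.
  by rewrite mul_row_block !(mul1mx, mul0mx, addr0).
by rewrite mul_block_col mul_col_mx !(mul1mx, mulmx1, mul0mx, mulmx0, addr0, add0r).
Qed.

Lemma ext_push_square L M N (e : cochain1 L M) (g : hom M N) :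
  exists h : hom (ext_rep e) (ext_rep (push0 e (sval g))),
    hom_comp (ext_in e) h = hom_comp g (ext_in _) /\
    hom_comp h (ext_out _) = ext_out e.
Proof.
pose E := ext_rep (push0 e (sval g)).
pose h0 : cochain0 (ext_rep e) E := [ffun v => block_mx (sval g v) 0 0 1%:M].
have h_hom : h0 \in @is_hom (ext_rep e) E.
  rewrite inE; apply/eqP/ffunP=> a; rewrite dffun0E !ffunE /= !mulmx_block !ffunE.
  by rewrite !(mul1mx, mulmx1, mul0mx, mulmx0, addr0, add0r) homP subrr.
exists (exist (fun h => h \in @is_hom (ext_rep e) E) h0 h_hom).
split; apply/val_inj/ffunP=> v; rewrite !ffunE.
  by rewrite mul_row_block mul_mx_row !(mul1mx, mulmx1, mul0mx, mulmx0, addr0).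
by rewrite mul_block_col !(mulmx1, mulmx0, add0r, addr0).
Qed.
End Representations.

Section GradedHom.
Variables (k : fieldType) (V : finType) (Q : quiver V).

Definition gext (M N : rep k Q) := (hom M N * ext M N)%type.
HB.instance Definition _ M N := GRing.Lmodule.on (gext M N).

(* Yoneda product, "first [x], then [y]"; Ext^1 * Ext^1 lands in Ext^2 = 0. *)
Definition gcomp (L M N : rep k Q) (x : gext L M) (y : gext M N) : gext L N :=
  (hom_comp x.1 y.1, ext_pull x.1 y.2 + ext_push x.2 y.1).

Definition gid (M : rep k Q) : gext M M := (hom_id M, 0).

Lemma gcompDl L M N (x x' : gext L M) (y : gext M N) :
  gcomp (x + x') y = gcomp x y + gcomp x' y.
Proof.
by rewrite /gcomp /= hom_compDl ext_pullDl ext_pushDl addrACA.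
Qed.
Lemma gcompDr L M N (x : gext L M) (y y' : gext M N) :
  gcomp x (y + y') = gcomp x y + gcomp x y'.
Proof.
by rewrite /gcomp /= hom_compDr ext_pullDr ext_pushDr addrACA.
Qed.
Lemma gcompZl c L M N (x : gext L M) (y : gext M N) :
  gcomp (c *: x) y = c *: gcomp x y.
Proof.
by rewrite /gcomp /= hom_compZl ext_pullZl ext_pushZl -scalerDr.
Qed.
Lemma gcompZr c L M N (x : gext L M) (y : gext M N) :
  gcomp x (c *: y) = c *: gcomp x y.
Proof.
by rewrite /gcomp /= hom_compZr ext_pullZr ext_pushZr -scalerDr.
Qed.
Lemma gcomp0l L M N (y : gext M N) : gcomp (0 : gext L M) y = 0.
Proof. by rewrite -(scale0r 0) gcompZl scale0r. Qed.
Lemma gcomp0r L M N (x : gext L M) : gcomp x (0 : gext M N) = 0.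
Proof. by rewrite -(scale0r 0) gcompZr scale0r. Qed.
Lemma gcompA K L M N (x : gext K L) (y : gext L M) (z : gext M N) :
  gcomp x (gcomp y z) = gcomp (gcomp x y) z.
Proof.
rewrite /gcomp /= hom_compA ext_pullDr ext_pushDl ext_pullA ext_pull_push ext_pushA.
by rewrite addrA.
Qed.
Lemma gcomp1l M N (x : gext M N) : gcomp (gid M) x = x.
Proof.
case: x => f x; rewrite /gcomp /= hom_comp1l ext_pull1.
by rewrite -[X in ext_push X](scale0r 0) ext_pushZl scale0r addr0.
Qed.
Lemma gcomp1r M N (x : gext M N) : gcomp x (gid N) = x.
Proof.
case: x => f x; rewrite /gcomp /= hom_comp1r ext_push1.
by rewrite -[X in ext_pull _ X](scale0r 0) ext_pullZr scale0r add0r.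
Qed.
End GradedHom.

Section ExtAlgebra.
Variables (k : fieldType) (V : finType) (Q : quiver V) (I : finType).
Variable E : I -> rep k Q.

Definition extalg := {dffun forall p : I * I, gext (E p.1) (E p.2)}.
HB.instance Definition _ := GRing.Lmodule.on extalg.

Definition gunit (i j : I) : gext (E i) (E j) :=
  if @eqP I i j is ReflectT ij then ecast l (gext (E i) (E l)) ij (gid (E i))
  else 0.

Lemma gunitE i : gunit i i = gid (E i).
Proof. by rewrite /gunit; case: eqP => // ii; rewrite eq_axiomK. Qed.
Lemma gunit_neq i j : i != j -> gunit i j = 0.
Proof. by rewrite /gunit; case: eqP. Qed.

Definition component (x : extalg) (i j : I) : gext (E i) (E j) := x (i, j).

Definition extalg_one : extalg := [ffun p => gunit p.1 p.2].
Definition extalg_mul (x y : extalg) : extalg :=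
  [ffun p => \sum_j gcomp (component x p.1 j) (component y j p.2)].

Lemma extalgP (x y : extalg) :
  (forall i j, component x i j = component y i j) -> x = y.
Proof. by move=> eq_xy; apply/ffunP=> -[i j]; apply: eq_xy. Qed.
Lemma component0 i j : component 0 i j = 0.
Proof. by rewrite /component ffunE. Qed.
Lemma componentD x y i j : component (x + y) i j = component x i j + component y i j.
Proof. by rewrite /component ffunE. Qed.
Lemma componentZ c x i j : component (c *: x) i j = c *: component x i j.
Proof. by rewrite /component ffunE. Qed.
Lemma component_one i j : component extalg_one i j = gunit i j.
Proof. by rewrite /component ffunE. Qed.
Lemma component_mul x y i j : component (extalg_mul x y) i j =
  \sum_l gcomp (component x i l) (component y l j).
Proof. by rewrite /component ffunE. Qed.

Fact extalg_mulDl : left_distributive extalg_mul +%R.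
Proof.
move=> x y z; apply: extalgP => i j; rewrite componentD !component_mul -big_split /=.
by apply: eq_bigr => l _; rewrite componentD gcompDl.
Qed.
Fact extalg_mulDr : right_distributive extalg_mul +%R.
Proof.
move=> x y z; apply: extalgP => i j; rewrite componentD !component_mul -big_split /=.
by apply: eq_bigr => l _; rewrite componentD gcompDr.
Qed.
Fact extalg_mulA : associative extalg_mul.
Proof.
move=> x y z; apply: extalgP => i j; rewrite !component_mul.
transitivity (\sum_l \sum_m
    gcomp (component x i l) (gcomp (component y l m) (component z m j))).
  apply: eq_bigr => l _; rewrite component_mul.
  by apply: (big_morph _ (gcompDr _) (gcomp0r _ _)).
rewrite exchange_big; apply: eq_bigr => m _; rewrite component_mul.
rewrite (big_morph (fun t => gcomp t (component z m j)) (id1 := 0) (op1 := +%R)).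
- by apply: eq_bigr => l _; rewrite gcompA.
- by move=> t u; rewrite gcompDl.
- by rewrite gcomp0l.
Qed.
Fact extalg_mul1l : left_id extalg_one extalg_mul.
Proof.
move=> x; apply: extalgP => i j; rewrite component_mul.
rewrite (bigD1 i) //= big1 => [|l li]; rewrite component_one.
  by rewrite gunitE gcomp1l addr0.
by rewrite gunit_neq 1?eq_sym // gcomp0l.
Qed.
Fact extalg_mul1r : right_id extalg_one extalg_mul.
Proof.
move=> x; apply: extalgP => i j; rewrite component_mul.
rewrite (bigD1 j) //= big1 => [|l lj]; rewrite component_one.
  by rewrite gunitE gcomp1r addr0.
by rewrite gunit_neq // gcomp0r.
Qed.
HB.instance Definition _ := GRing.Zmodule_isPzRing.Build extalg
  extalg_mulA extalg_mul1l extalg_mul1r extalg_mulDl extalg_mulDr.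

Lemma component_mulr (x y : extalg) i j :
  component (x * y) i j = \sum_l gcomp (component x i l) (component y l j).
Proof. exact: component_mul. Qed.

Lemma extalg_scaleAl c (x y : extalg) : c *: (x * y) = (c *: x) * y.
Proof.
apply: extalgP => i j; rewrite componentZ !component_mulr scaler_sumr.
by apply: eq_bigr => l _; rewrite componentZ gcompZl.
Qed.
Lemma extalg_scaleAr c (x y : extalg) : c *: (x * y) = x * (c *: y).
Proof.
apply: extalgP => i j; rewrite componentZ !component_mulr scaler_sumr.
by apply: eq_bigr => l _; rewrite componentZ gcompZr.
Qed.

(* Membership in the summand [gext (E i) (E j)]. *)
Definition in_block (i j : I) (x : extalg) : Prop :=
  forall l m, (l, m) != (i, j) -> component x l m = 0.

(* The identity of [E i]. *)
Definition idem (i : I) : extalg :=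
  [ffun p => if p == (i, i) then gunit p.1 p.2 else 0].
End ExtAlgebra.

Section Jacobson.
Variable A : pzRingType.

Definition left_ideal (J : A -> Prop) : Prop :=
  [/\ J 0, forall x y, J x -> J y -> J (x + y) & forall a x, J x -> J (a * x)].

Definition maximal_left_ideal (J : A -> Prop) : Prop :=
  [/\ left_ideal J, ~ J 1 &
      forall K, left_ideal K -> (forall x, J x -> K x) ->
        K 1 \/ forall x, K x -> J x].

Definition jacobson (x : A) : Prop := forall J, maximal_left_ideal J -> J x.

Definition jacobson_sq (x : A) : Prop :=
  exists s : seq (A * A),
    (forall yz, yz \in s -> jacobson yz.1 /\ jacobson yz.2) /\
    x = \sum_(yz <- s) yz.1 * yz.2.
End Jacobson.

Section Paths.
Variables (V : finType) (Q : quiver V).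

(* [(v, s)] is the path starting at [v] and following the arrows of [s] in
   order; [(v, [::])] is the trivial path at [v]. *)
Fixpoint is_path (v : V) (s : seq (arr Q)) : bool :=
  if s is a :: s' then (src a == v) && is_path (tgt a) s' else true.

Definition qpath := {p : V * seq (arr Q) | is_path p.1 p.2}.
End Paths.

(* [bq_rel] is a subset of the path algebra, whose underlying vector space is
   the free one on the set of paths. *)
Record bound_quiver (k : fieldType) (V : finType) := BoundQuiver {
  bq_quiver :> quiver V;
  bq_rel : {malg k[qpath bq_quiver]} -> Prop }.

Record quiver_iso (V V' : finType) (Q : quiver V) (Q' : quiver V') := QuiverIso {
  iso_vert : V -> V';
  iso_arr : arr Q -> arr Q';
  iso_vert_bij : bijective iso_vert;
  iso_arr_bij : bijective iso_arr;
  iso_src : forall a, src (iso_arr a) = iso_vert (src a);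
  iso_tgt : forall a, tgt (iso_arr a) = iso_vert (tgt a) }.

Section Isomorphism.
Variables (k : fieldType) (V V' : finType).

Section Induced.
Variables (Q : quiver V) (Q' : quiver V') (f : quiver_iso Q Q').

Fact iso_is_path v s :
  is_path v s -> is_path (iso_vert f v) (map (iso_arr f) s).
Proof.
elim: s v => //= a s IHs v /andP[/eqP <- /IHs].
by rewrite iso_src iso_tgt eqxx.
Qed.

Definition iso_path (p : qpath Q) : qpath Q' :=
  exist (fun p => is_path p.1 p.2)
    (iso_vert f (val p).1, map (iso_arr f) (val p).2) (iso_is_path (valP p)).

Definition iso_pathalg (x : {malg k[qpath Q]}) : {malg k[qpath Q']} :=
  \sum_(p <- msupp x) << x@_p *g iso_path p >>.
End Induced.

Definition bound_quiver_iso (Q : bound_quiver k V) (Q' : bound_quiver k V') : Prop :=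
  exists f : quiver_iso Q Q', forall y,
    bq_rel y <-> exists2 x : {malg k[qpath Q]}, bq_rel x & y = iso_pathalg f x.
End Isomorphism.

Section HomExtQuiver.
Variables (k : fieldType) (V : finType) (Q : quiver V) (I : finType).
Variable E : I -> rep k Q.
Local Notation A := (extalg E).

(* For all [i] and [j], the values of [ell] on the arrows from [i] to [j] induce
   a basis of the [(i, j)] component of rad / rad^2; in particular the number of
   these arrows is the dimension of that component. *)
Definition arrow_lift (G : quiver I) (ell : arr G -> A) : Prop :=
  (forall a, jacobson (ell a) /\ in_block (src a) (tgt a) (ell a)) /\
  forall i j : I,
    (forall c : arr G -> k,
       jacobson_sq (\sum_(a | (src a == i) && (tgt a == j)) c a *: ell a) ->
       forall a, src a = i -> tgt a = j -> c a = 0) /\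
    (forall x : A, jacobson x -> in_block i j x ->
       exists c : arr G -> k,
         jacobson_sq (x - \sum_(a | (src a == i) && (tgt a == j)) c a *: ell a)).

Definition path_value (G : quiver I) (ell : arr G -> A) (p : qpath G) : A :=
  idem E (val p).1 * \prod_(a <- (val p).2) ell a.

Definition pathalg_eval (G : quiver I) (ell : arr G -> A)
    (x : {malg k[qpath G]}) : A :=
  \sum_(p <- msupp x) x@_p *: path_value ell p.

(* The relations depend on the choice of the lifts, so "being a Hom-Ext quiver
   with relations of [E]" is a predicate. *)
Definition hom_ext_quiver (G : bound_quiver k I) : Prop :=
  exists ell : arr G -> A,
    arrow_lift ell /\ forall x, bq_rel x <-> pathalg_eval ell x = 0.
End HomExtQuiver.

Section RelativeBasis.
Variables (k : fieldType) (W : lmodType k).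

Lemma relative_basis (m : nat) (P S : W -> Prop) :
  (forall r (u : 'I_r -> W), (m < r)%N ->
     exists2 c : 'I_r -> k, \sum_i c i *: u i = 0 & exists i, c i != 0) ->
  S 0 -> (forall x y, S x -> S y -> S (x + y)) -> (forall c x, S x -> S (c *: x)) ->
  exists d : {r : nat & 'I_r -> W},
    [/\ forall i, P (tagged d i),
        forall c, S (\sum_i c i *: tagged d i) -> forall i, c i = 0 &
        forall x, P x -> exists c, S (x - \sum_i c i *: tagged d i)].
Proof.
move=> dep S0 SD SZ.
pose good r (u : 'I_r -> W) := (forall i, P (u i)) /\
  forall c, S (\sum_i c i *: u i) -> forall i, c i = 0.
pose size_ok r := `[< exists u : 'I_r -> W, good r u >].
have ex0 : exists r, size_ok r.
  exists 0%N; apply/asboolP; exists (fun _ => 0); split=> [[]//|c _ []//].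
have bound r : size_ok r -> (r <= m)%N.
  move=> /asboolP[u [_ indep]]; rewrite leqNgt; apply/negP => /dep-/(_ u)[c].
  by move=> c0 [i /eqP[]]; apply: indep; rewrite c0.
case: (ex_maxnP ex0 bound) => r /asboolP[u [Pu indep]] maxr.
exists (Tagged (fun r => 'I_r -> W) u); split=> //= x Px.
pose u' (i : 'I_r.+1) := oapp u x (unlift ord0 i).
have: ~ good r.+1 u'.
  move=> good_u'; have /maxr: size_ok r.+1 by apply/asboolP; exists u'.
  by rewrite ltnn.
move=> bad; apply: contrapT => no_c; apply: bad; split=> [i|c].
  by rewrite /u'; case: unliftP => [j|] _ /=.
rewrite big_ord_recl /u' unlift_none /=.
under eq_bigr => i _ do rewrite liftK /=.
move=> Sc; have [c0|c0] := eqVneq (c ord0) 0.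
  move: Sc; rewrite c0 scale0r add0r => /indep ci0 i.
  by have [j ->|->] := unliftP ord0 i; [apply: ci0 | rewrite c0].
case: no_c; exists (fun i => - ((c ord0)^-1 * c (lift ord0 i))).
have /= := SZ (c ord0)^-1 _ Sc; rewrite scalerDr scalerA mulVf // scale1r.
congr (S (_ + _)); rewrite scaler_sumr -sumrN.
by apply: eq_bigr => i _; rewrite scalerA scaleNr opprK.
Qed.
End RelativeBasis.

Section Existence.
Variables (k : fieldType) (V : finType) (Q : quiver V) (I : finType).
Variable E : I -> rep k Q.
Local Notation A := (extalg E).

Lemma extalg_dependent : exists m, forall r (u : 'I_r -> A), (m < r)%N ->
  exists2 c : 'I_r -> k, \sum_i c i *: u i = 0 & exists i, c i != 0.
Proof.
pose T0 := {p : I * I & {v : V & 'I_(rdim (E p.1) v) * 'I_(rdim (E p.2) v)}%type}.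
pose T1 := {p : I * I & {a : arr Q &
  'I_(rdim (E p.1) (src a)) * 'I_(rdim (E p.2) (tgt a))}%type}.
pose T : finType := (T0 + T1)%type.
pose w (x : A) (t : T) : k := match t with
  | inl t => let: existT p (existT v rc) := t in
      sval (component x p.1 p.2).1 v rc.1 rc.2
  | inr t => let: existT p (existT a rc) := t in
      ext_repr (component x p.1 p.2).2 a rc.1 rc.2
  end.
exists #|T| => r u lt_r.
pose M : 'M[k]_(r, #|T|) := \matrix_(i, t) w (u i) (enum_val t).
have: kermx M != 0.
  by rewrite -mxrank_eq0 mxrank_ker subn_eq0 -ltnNge (leq_ltn_trans (rank_leq_col M)).
move=> /rowV0Pn[c /sub_kermxP cM0 c_neq0].
have cw t : \sum_i c 0 i * w (u i) t = 0.
  have := congr1 (fun X : 'rV_ _ => X 0 (enum_rank t)) cM0.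
  rewrite !mxE => cM0t; rewrite -[RHS]cM0t; apply: eq_bigr => i _.
  by rewrite mxE enum_rankK.
exists (fun i => c 0 i); last first.
  apply/existsP; rewrite -negb_forall; apply: contra c_neq0 => /forallP c0.
  by apply/eqP/rowP=> i; rewrite mxE; apply/eqP.
apply: extalgP => i j; rewrite component0.
rewrite (big_morph (fun x => component x i j) (fun x y => componentD x y i j)
  (component0 E i j)).
under eq_bigr => l _ do rewrite componentZ.
apply: injective_projections.
  rewrite (big_morph (@fst _ _) (id1 := 0) (op1 := +%R)) //=.
  apply/val_inj; rewrite raddf_sum; apply/ffunP=> v; apply/matrixP=> a b.
  rewrite dffun_sumE summxE /= dffun0E mxE.
  rewrite -[RHS](cw (inl (existT _ (i, j) (existT _ v (a, b))))).
  by apply: eq_bigr => l _ /=; rewrite dffunZE mxE.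
rewrite (big_morph (@snd _ _) (id1 := 0) (op1 := +%R)) //=.
transitivity (ext_class (\sum_l c 0 l *: ext_repr (component (u l) i j).2)).
  rewrite raddf_sum; apply: eq_bigr => l _ /=.
  by rewrite -ext_scaleE ext_reprK.
rewrite -(raddf0 (@ext_class k V Q (E i) (E j))); congr (ext_class _).
apply/ffunP=> a; apply/matrixP=> b b'.
rewrite dffun_sumE summxE dffun0E mxE.
rewrite -[RHS](cw (inr (existT _ (i, j) (existT _ a (b, b'))))).
by apply: eq_bigr => l _ /=; rewrite dffunZE mxE.
Qed.

Lemma jacobsonZ c (x : A) : jacobson x -> jacobson (c *: x).
Proof.
move=> Jx J maxJ; have [[_ _ JM] _ _] := maxJ.
by rewrite -[x]mul1r extalg_scaleAl; apply: JM; apply: Jx.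
Qed.

Lemma hom_ext_quiver_exists : exists G, hom_ext_quiver E G.
Proof.
have [m dep] := extalg_dependent.
have S0 : jacobson_sq (0 : A) by exists [::]; rewrite big_nil.
have SD (x y : A) : jacobson_sq x -> jacobson_sq y -> jacobson_sq (x + y).
  move=> [s [Js ->]] [t [Jt ->]]; exists (s ++ t); rewrite big_cat; split=> // yz.
  by rewrite mem_cat => /orP[/Js|/Jt].
have SZ c (x : A) : jacobson_sq x -> jacobson_sq (c *: x).
  move=> [s [Js ->]]; exists [seq (c *: yz.1, yz.2) | yz <- s]; split=> [yz|].
    by move=> /mapP[yz' /Js[J1 J2] ->]; split=> //=; apply: jacobsonZ.
  by rewrite big_map scaler_sumr; apply: eq_bigr => yz _; rewrite extalg_scaleAl.
have /choice[d dP] (p : I * I) := relative_basis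
  (fun x : A => jacobson x /\ in_block p.1 p.2 x) dep S0 SD SZ.
pose arrow : finType := {p : I * I & 'I_(tag (d p))}.
pose G := @Quiver I arrow (fun a => (tag a).1) (fun a => (tag a).2).
pose mk p l : arr G := existT (fun p => 'I_(tag (d p))) p l.
pose ell (a : arr G) : A := tagged (d (tag a)) (tagged a).
exists (BoundQuiver (fun x : {malg k[qpath G]} => pathalg_eval ell x = 0)).
exists ell; split=> //; split=> [a|i j].
  by have [/(_ (tagged a))] := dP (tag a).
have sumE (c : arr G -> k) :
    \sum_(a | (src a == i) && (tgt a == j)) c a *: ell a =
    \sum_l c (mk (i, j) l) *: tagged (d (i, j)) l.
  pose F p l := c (mk p l) *: tagged (d p) l.
  transitivity (\sum_(a : arr G | (tag a == (i, j)) && true) F (tag a) (tagged a)).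
    by apply: eq_big => [[[i' j'] l]|[p l] _] //; rewrite andbT.
  by rewrite -(sig_big_dep (fun p => p == (i, j)) (fun _ _ => true) F) big_pred1_eq.
have [_ indep span] := dP (i, j); split=> [c|x Jx bx].
  rewrite sumE => /indep c0 [[i' j'] l] /= ei ej; move: l; rewrite ei ej => l.
  exact: c0.
have [c Sc] := span x (conj Jx bx).
pose c' (a : arr G) : k :=
  if tag a =P (i, j) is ReflectT e then c (ecast p ('I_(tag (d p))) e (tagged a)) else 0.
exists c'; rewrite sumE; move: Sc; congr (jacobson_sq (_ - _)).
apply: eq_bigr => l _; congr (_ *: _).
by rewrite /c' /=; case: eqP => // e; rewrite eq_axiomK.
Qed.
End Existence.

Section TypeA.
Variables (k : fieldType) (n : nat).

Fact succ_ord_subproof (a : 'I_n.-1) : (a.+1 < n)%N.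
Proof. by rewrite -ltn_predRL. Qed.

(* The vertex [v : 'I_n] is the vertex v + 1 of 1 -> 2 -> ... -> n. *)
Definition linear_quiver : quiver 'I_n :=
  @Quiver 'I_n 'I_n.-1 (widen_ord (leq_pred n))
    (fun a => Ordinal (succ_ord_subproof a)).

Local Notation module := (rep k linear_quiver).

(* All nonzero entries are 1 x 1, so [const_mx 1] is the identity there. *)
Definition interval_module (i j : 'I_n.+1) : module :=
  @Rep k 'I_n linear_quiver (fun v => nat_of_bool (i <= v < j)%N)
    (fun a => const_mx 1).

Definition complete_exceptional_collection (chi : 'I_n -> module) : Prop :=
  exists s : 'S_n, exceptional_sequence (fun i => chi (s i)).

(* The chord c_{i,j} is the set of its endpoints. *)
Definition tree (chi : 'I_n -> module) : {set {set 'I_n.+1}} :=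
  [set c | `[< exists i j : 'I_n.+1,
      [/\ (i < j)%N, c = [set i; j] &
          exists a, rep_iso (chi a) (interval_module i j)] >]].

Definition rotation (T : {set {set 'I_n.+1}}) : {set {set 'I_n.+1}} :=
  [set [set ordS x | x in c] | c : {set 'I_n.+1} in T].
End TypeA.

(* Main.v *)
From mathcomp Require Import all_boot all_fingroup all_algebra.
From mathcomp Require Import finmap boolp.
From mathcomp.multinomials Require Import monalg.
From mathcomp Require Import zify.
Require Import Defs.
Set Implicit Arguments.
Unset Strict Implicit.
Unset Printing Implicit Defensive.
Import GRing.Theory.
Local Open Scope ring_scope.

(** The quiver with relations of a complete exceptional collection depends only
    on a relation between chords, and that relation determines the tree up to
    rotation.

    Reduction to a relation. An indecomposable representation of the linear
    quiver is an interval module (indecomposable_interval), so a collection is a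
    family of chords. For interval modules, Hom and Ext^1 are at most
    one-dimensional and never both nonzero; arrow_rel says when their sum is
    nonzero, and the product of two generators is a generator whenever its
    target is nonzero (gext_unit_comp). Hence the Ext algebra has a basis
    indexed by the pairs in arrow_rel, with structure constants 0 and 1, like an
    incidence algebra, except that arrow_rel is not transitive. Its radical
    consists of the elements without diagonal components, its arrows are the
    covering pairs of arrow_rel, and a path is nonzero in it exactly when its
    source is related to every vertex on it. Two nonzero paths with the same
    ends are equal, so the ideal of relations is spanned by the zero paths, for
    every choice of lifts of the arrows (hom_ext_quiver_presented). It follows
    that two such quivers with relations are isomorphic if and only if some
    bijection between the chords preserves arrow_rel (bound_iso_rel,
    rel_bound_iso).

    Combinatorics. The chords of an exceptional collection do not cross, since a
    crossing gives nonzero maps or extensions in both directions, and they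
    connect all the vertices, since their dimension vectors form a basis
    (chords_connected). For two such chords, arrow_rel means that they share an
    endpoint v and that the other end of the first one comes before the other
    end of the second one in the cyclic order v - 1, v - 2, ..., v + 1
    (arrow_rel_turn, arrow_rel_share). Rotations preserve this (rotated_trees).
    Conversely, let phi be a bijection between two families of chords that
    preserves arrow_rel. Three chords that meet pairwise have a common endpoint,
    so phi comes from a bijection psi between the vertices (vertex_image). The
    product, in the exceptional order, of the transpositions of the endpoints of
    the chords is the cycle v |-> v - 1 (walk_end). As phi transports the
    exceptional order, psi commutes with this cycle, so it is a rotation
    (recover_rotation). *)

(** * Chords and their order *)

Section Intervals.
Variable n : nat.
Notation V := 'I_n.+1.
Implicit Types c d : V * V.
Local Open Scope nat_scope.

Definition hom_rel c d := [&& d.1 <= c.1, c.1 < d.2 & d.2 <= c.2].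
Definition ext_rel c d := [&& c.1 < d.1, d.1 <= c.2 & c.2 < d.2].
Definition arrow_rel c d := hom_rel c d || ext_rel c d.

(** The chord [(i, j)] with [i < j] stands for the interval module [X_{i,j}];
    [hom_rel] and [ext_rel] describe when Hom and Ext^1 between two of these
    modules are nonzero, so this is the exceptionality of the sequence. *)
Definition exceptional_intervals (c : 'I_n -> V * V) :=
  (forall a, (c a).1 < (c a).2) /\
  forall a b : 'I_n, b < a -> ~~ arrow_rel (c a) (c b).

Definition crossing c d := (c.1 < d.1 < c.2) && (c.2 < d.2).

Definition ends c (x y : V) := (c == (x, y)) || (c == (y, x)).

(** The subtraction is the one of Z/(n+1): [v - x], read as a natural number, is
    the number of unit steps down from [v] to [x]. *)
Lemma ordB_spec (x y : V) :
  (y <= x /\ ((x - y)%R : nat) + y = x) \/ (x < y /\ ((x - y)%R : nat) + y = x + n.+1).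
Proof.
have := ltn_ord x; have := ltn_ord y.
rewrite /= !modnDmr => lty ltx.
case: (leqP y x) => xy; [left|right]; split=> //.
  have -> : x + (n.+1 - y) = (x - y) + n.+1 by lia.
  by rewrite modnDr modn_small; lia.
by rewrite modn_small; lia.
Qed.

Section Exceptional.
Variable c : 'I_n -> V * V.
Hypothesis exc : exceptional_intervals c.

Lemma interval_lt a : (c a).1 < (c a).2. Proof. by case: exc. Qed.

Lemma arrow_rel_refl a : arrow_rel (c a) (c a).
Proof. rewrite /arrow_rel /hom_rel !leqnn interval_lt //. Qed.

Lemma arrow_rel_le a b : arrow_rel (c a) (c b) -> a <= b.
Proof. by move=> ab; rewrite leqNgt; apply/negP=> /(proj2 exc); rewrite ab. Qed.

Lemma arrow_rel_anti a b : arrow_rel (c a) (c b) -> arrow_rel (c b) (c a) -> a = b.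
Proof.
by move=> /arrow_rel_le ab /arrow_rel_le ba; apply/val_inj/eqP; rewrite eqn_leq ab.
Qed.

Lemma interval_inj : injective c.
Proof.
by move=> a b cab; apply: arrow_rel_anti; [rewrite -cab | rewrite cab]; exact: arrow_rel_refl.
Qed.

(** Two crossing chords have a nonzero homomorphism in one direction and a
    nonzero extension in the other, which an exceptional sequence forbids. *)
Lemma noncrossing a b : ~~ crossing (c a) (c b).
Proof.
apply/negP=> cr; have [ab ba] : arrow_rel (c a) (c b) /\ arrow_rel (c b) (c a).
  move: cr (interval_lt a) (interval_lt b).
  rewrite /crossing /arrow_rel /hom_rel /ext_rel; lia.
by move: cr; rewrite (arrow_rel_anti ab ba) /crossing; lia.
Qed.

Lemma endsC a x y : ends a x y = ends a y x. Proof. by rewrite /ends orbC. Qed.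

Lemma ends_neq a x y : ends (c a) x y -> x != y.
Proof.
move=> e; apply/eqP=> xy; move: e (interval_lt a); rewrite xy /ends orbb => /eqP -> /=.
by rewrite ltnn.
Qed.

Lemma ends_inj a b x y : ends (c a) x y -> ends (c b) x y -> a = b.
Proof.
move=> ea eb; apply: interval_inj; move: ea eb (interval_lt a) (interval_lt b).
rewrite /ends => /orP[]/eqP-> /orP[]/eqP-> //=; lia.
Qed.

Lemma endsP a x y : ends (c a) x y ->
  ((c a).1 = x /\ (c a).2 = y /\ x < y) \/ ((c a).1 = y /\ (c a).2 = x /\ y < x).
Proof.
move=> e; move: e (interval_lt a); rewrite /ends.
by move=> /orP[]/eqP -> /=; [left|right].
Qed.

(** This form of the relation depends only on differences in Z/(n+1); it is the
    reason why rotations preserve it. *)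
Lemma arrow_rel_turn a b v x y : ends (c a) v x -> ends (c b) v y -> a != b ->
  arrow_rel (c a) (c b) = ((v - x)%R < (v - y)%R).
Proof.
move=> ea eb ab.
have xy : x != y.
  by apply: contra ab => /eqP xy; apply/eqP; apply: (ends_inj ea); rewrite xy.
have := ordB_spec v x; have := ordB_spec v y.
have := ltn_ord v; have := ltn_ord x; have := ltn_ord y.
move: ((v - x)%R : nat) ((v - y)%R : nat) => p q.
have := endsP ea; have := endsP eb; rewrite /arrow_rel /hom_rel /ext_rel.
move: xy; rewrite -val_eqE /=.
by case=> [] xy [[-> [->]]|[-> [->]]] ? [[-> [->]]|[-> [->]]] ? /= ? ? ?; lia.
Qed.

Lemma arrow_rel_share a b : arrow_rel (c a) (c b) -> a != b ->
  exists v x y, ends (c a) v x /\ ends (c b) v y.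
Proof.
move=> ab nab.
have [e|[e|e]] : ((c a).1 = (c b).1 \/ (c a).2 = (c b).2 \/ (c a).2 = (c b).1).
  have := noncrossing a b; have := noncrossing b a.
  move: ab; rewrite /arrow_rel /hom_rel /ext_rel /crossing.
  move=> H H1 H2.
  have [/val_inj|] := eqVneq (val (c a).1) (val (c b).1); first by left.
  have [/val_inj|] := eqVneq (val (c a).2) (val (c b).2); first by right; left.
  have [/val_inj|] := eqVneq (val (c a).2) (val (c b).1); first by right; right.
  by move=> /= ? ? ?; lia.
- exists (c a).1, (c a).2, (c b).2; rewrite /ends [in X in _ /\ X]e -!surjective_pairing.
  by rewrite !eqxx.
- exists (c a).2, (c a).1, (c b).1; rewrite /ends [in X in _ /\ X]e -!surjective_pairing.
  by rewrite !eqxx !orbT.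
exists (c a).2, (c a).1, (c b).2; rewrite /ends [in X in _ /\ X]e -!surjective_pairing.
by rewrite !eqxx !orbT.
Qed.

Lemma ends_other a x y z : ends (c a) x y -> ends (c a) x z -> y = z.
Proof.
move=> /endsP e1 /endsP; move: e1.
by case=> [] [-> [-> ?]] [] [e1 [e2 ?]] //; subst; lia.
Qed.

(** Along the three sides of a triangle the relation would go round in a circle,
    in one of the two directions. *)
Lemma no_triangle (a b d : 'I_n) x y z :
  ends (c a) x y -> ends (c b) y z -> ends (c d) z x -> False.
Proof.
move=> ea eb ed.
have: ~ ([/\ arrow_rel (c a) (c b), arrow_rel (c b) (c d) & arrow_rel (c d) (c a)] \/
        [/\ arrow_rel (c b) (c a), arrow_rel (c d) (c b) & arrow_rel (c a) (c d)]).
  have le2 i j k : arrow_rel (c i) (c j) -> arrow_rel (c j) (c k) ->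
      arrow_rel (c k) (c i) -> i = j.
    move=> /arrow_rel_le ij /arrow_rel_le jk /arrow_rel_le ki; apply/val_inj/eqP.
    by rewrite eqn_leq ij (leq_trans jk ki).
  have nab : a != b.
    apply/eqP=> eab; have xz : x = z by apply: (@ends_other b y); rewrite // endsC -eab.
    by have := ends_neq ed; rewrite xz eqxx.
  by case=> [] [h1 h2 h3]; case/eqP: nab; [apply: le2 h1 h2 h3 | symmetry; apply: le2 h1 h3 h2].
case; move: (endsP ea) (endsP eb) (endsP ed); rewrite /arrow_rel /hom_rel /ext_rel.
have P (b1 b2 b3 b4 b5 b6 : bool) : b1 && b2 && b3 || b4 && b5 && b6 ->
   [/\ b1, b2 & b3] \/ [/\ b4, b5 & b6].
  by case/orP=> /andP[/andP[-> ->] ->]; [left|right].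
by case=> [] [-> [-> ?]] [] [-> [-> ?]] [] [-> [-> ?]]; apply: P; lia.
Qed.

End Exceptional.
End Intervals.

Section Connected.
Variable n : nat.
Notation V := 'I_n.+1.
Variable c : 'I_n -> V * V.
Hypothesis exc : exceptional_intervals c.

(** The matrix [D *m B^T] below is that of the Euler form (dimension of Hom minus
    dimension of Ext^1) on the collection. It is unitriangular, so the rows of
    [B], which are the dimension vectors, form a basis. If [P] is constant on
    every chord, then the differences of consecutive values of [P] form a vector
    [y] with [B *m y = 0], so [P] is constant. *)
Lemma chords_connected (P : pred V) :
  (forall a, P (c a).1 = P (c a).2) -> forall x y, P x = P y.
Proof.
move=> closedP.
pose inside a (v : nat) : rat := ((c a).1 <= v < (c a).2)%N%:R.
pose B := \matrix_(a < n, v < n) inside a v.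
pose D := \matrix_(a < n, v < n) ((v == (c a).1 :> nat)%:R - (v == (c a).2 :> nat)%:R : rat).
pose h (v : nat) : rat := (P (inord v))%:R.
pose y : 'cV_n := \col_(v < n) (h v.+1 - h v).
(* Hom minus Ext^1 for two intervals is the indicator of the second one,
   evaluated on the boundary of the first. *)
have DB a b : (D *m B^T) a b = inside b (c a).1 - inside b (c a).2.
  rewrite mxE; under eq_bigr => v _ do rewrite !mxE mulrBl.
  rewrite sumrB; congr (_ - _).
    have lt1 : ((c a).1 < n)%N by have := interval_lt exc a; have := ltn_ord (c a).2; lia.
    rewrite (bigD1 (Ordinal lt1)) //= eqxx mul1r big1 ?addr0 // => v.
    by rewrite -val_eqE /= => /negPf ->; rewrite mul0r.
  have [ltn|gen] := ltnP (c a).2 n.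
    rewrite (bigD1 (Ordinal ltn)) //= eqxx mul1r big1 ?addr0 // => v.
    by rewrite -val_eqE /= => /negPf ->; rewrite mul0r.
  rewrite big1 => [|v _]; last first.
    have vn := ltn_ord v; have -> : (v == (c a).2 :> nat) = false by lia.
    by rewrite mul0r.
  have lt2 := ltn_ord (c b).2; rewrite /inside.
  by have -> : ((c b).1 <= (c a).2 < (c b).2)%N = false by lia.
have U_trig : is_trig_mx (D *m B^T)^T.
  apply/is_trig_mxP=> a b lt_ab; rewrite mxE DB /inside.
  have := proj2 exc b a lt_ab; have := interval_lt exc a; have := interval_lt exc b.
  rewrite /arrow_rel /hom_rel /ext_rel => ? ? ?.
  have -> : ((c a).1 <= (c b).1 < (c a).2)%N = ((c a).1 <= (c b).2 < (c a).2)%N by lia.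
  by rewrite subrr.
have detU : \det (D *m B^T) = 1.
  rewrite -det_tr det_trig // big1 // => a _; rewrite mxE DB /inside.
  by have := interval_lt exc a => lt_a; rewrite leqnn lt_a ltnn andbF subr0.
have unitB : B \in unitmx.
  rewrite -unitmx_tr; have : D *m B^T \in unitmx by rewrite unitmxE detU unitr1.
  by rewrite unitmx_mul => /andP[].
have By0 : B *m y = 0.
  apply/colP=> a; rewrite !mxE; under eq_bigr => v _ do rewrite !mxE.
  have -> : \sum_(v < n) inside a v * (h v.+1 - h v) = h (c a).2 - h (c a).1.
    rewrite -(telescope_sumr _ (ltnW (interval_lt exc a))).
    rewrite -(big_mkord xpredT (fun v => inside a v * (h v.+1 - h v))).
    have le_n : ((c a).2 <= n)%N by rewrite -ltnS ltn_ord.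
    rewrite [RHS](big_nat_widen _ _ n) // [RHS](big_nat_widenl _ 0) // [RHS]big_mkcond.
    apply: eq_bigr => v _.
    by rewrite /inside /= [(_ < (c a).2)%N && _]andbC; case: ifP; rewrite ?mul1r ?mul0r.
  by rewrite /h !inord_val closedP subrr.
have y0 : y = 0 by rewrite -(mulKmx unitB y) By0 mulmx0.
have step (v : nat) : (v < n)%N -> P (inord v.+1) = P (inord v).
  move=> lt_vn; have /eqP := congr1 (fun z : 'cV_n => z (Ordinal lt_vn) 0) y0.
  rewrite !mxE subr_eq0 /h /= Num.Theory.eqr_nat; case: (P _); case: (P _) => //.
suff P0 x : P x = P ord0 by move=> x x'; rewrite !P0.
have: (x <= n)%N by rewrite -ltnS.
rewrite -[in P x](inord_val x); elim: (val x) => [_|m IHm ltm].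
  by congr P; apply/val_inj; rewrite /= inordK.
by rewrite step // IHm // ltnW.
Qed.

(** The exceptional order refines the cyclic order of the chords at each
    vertex. *)
Lemma cyclic_order a b v x y : ends (c a) v x -> ends (c b) v y -> (a < b)%N ->
  ((v - x)%R < (v - y)%R)%N.
Proof.
move=> ea eb lt_ab; have nab : a != b by rewrite -val_eqE neq_ltn lt_ab.
have [xy|xy|] := ltngtP (v - x)%R (v - y)%R => //.
- have := proj2 exc _ _ lt_ab; rewrite (arrow_rel_turn exc eb ea) 1?eq_sym //.
  by rewrite xy.
by move=> /val_inj /(addrI v) /oppr_inj exy; case/eqP: nab; apply: (ends_inj exc ea); rewrite exy.
Qed.

Lemma noncrossing_cyclic a b u w x y z : ends (c a) x w -> ends (c b) y z ->
  ((u - y)%R < (u - x)%R)%N -> ((u - x)%R < (u - z)%R)%N -> ((u - z)%R < (u - w)%R)%N -> False.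
Proof.
move=> ea eb.
have := ordB_spec u x; have := ordB_spec u y; have := ordB_spec u z; have := ordB_spec u w.
have := ltn_ord u; have := ltn_ord x; have := ltn_ord y; have := ltn_ord z; have := ltn_ord w.
move: ((u - x)%R : nat) ((u - y)%R : nat) ((u - z)%R : nat) ((u - w)%R : nat) => dx dy dz dw.
have := noncrossing exc a b; have := noncrossing exc b a; rewrite /crossing.
by have := endsP exc ea; have := endsP exc eb; case=> [] [-> [-> ?]] [] [-> [-> ?]]; lia.
Qed.

(** Translates between distances measured down from a fixed vertex [u] and the
    order of the chords at a vertex [w]. *)
Lemma turn_base (u w x : V) :
  ((u - w)%R <= (u - x)%R /\ ((w - x)%R : nat) = (u - x)%R - (u - w)%R)%N \/
  ((u - x)%R < (u - w)%R /\ ((w - x)%R : nat) = (u - x)%R + n.+1 - (u - w)%R)%N.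
Proof.
have := ordB_spec u x; have := ordB_spec u w; have := ordB_spec w x.
have := ltn_ord u; have := ltn_ord x; have := ltn_ord w; lia.
Qed.

Lemma turn_lt (u w x y : V) : ((u - y)%R < (u - x)%R)%N -> ((u - x)%R < (u - w)%R)%N ->
  ((w - y)%R < (w - x)%R)%N.
Proof.
have := turn_base u w x; have := turn_base u w y; have := ltn_ord (u - w)%R; lia.
Qed.

Lemma turn_gt (u w x y : V) : ((u - y)%R < (u - x)%R)%N -> ((u - x)%R < (u - w)%R)%N ->
  ((x - w)%R < (x - y)%R)%N.
Proof.
have := turn_base u x w; have := turn_base u x y; have := ltn_ord (u - w)%R; lia.
Qed.

Lemma turn_le (u w x z : V) : ((u - x)%R <= (u - z)%R)%N -> ((u - z)%R < (u - w)%R)%N ->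
  ((x - z)%R < (x - w)%R)%N.
Proof.
have := turn_base u x w; have := turn_base u x z; lia.
Qed.

(** The trajectory of [v] under the transpositions of the endpoints of the chords,
    taken in the exceptional order. *)
Definition walk (v : V) (t : nat) : V :=
  foldl (fun w a => tperm (c a).1 (c a).2 w) v (take t (enum 'I_n)).

Lemma tperm_ends a x y : ends (c a) x y -> tperm (c a).1 (c a).2 x = y.
Proof. by move=> /orP[]/eqP -> /=; rewrite ?tpermL ?tpermR. Qed.

Lemma ends_spec a w : tperm (c a).1 (c a).2 w = w /\ (forall x, ~~ ends (c a) w x) \/
  exists x, ends (c a) w x.
Proof.
have [w1|w1] := eqVneq w (c a).1.
  by right; exists (c a).2; rewrite /ends w1 -surjective_pairing eqxx.
have [w2|w2] := eqVneq w (c a).2.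
  by right; exists (c a).1; rewrite /ends w2 -surjective_pairing eqxx orbT.
left; rewrite tpermD 1?eq_sym //; split=> // x; apply/negP=> /orP[]/eqP cE.
  by rewrite cE eqxx in w1.
by rewrite cE eqxx in w2.
Qed.

Lemma walkS v (a : 'I_n) : walk v a.+1 = tperm (c a).1 (c a).2 (walk v a).
Proof.
rewrite /walk (take_nth a) ?size_enum_ord //.
by rewrite -cats1 foldl_cat /= nth_ord_enum.
Qed.

(** Measure distances down from [u = v - 1], so that [v] is the farthest vertex
    and [u] the nearest one. The walk from [v] only moves towards [u], and the
    region [S] of the vertices nearer to [u] than its position [w] can be left
    only through [w], by a chord that has not had its turn; moreover every chord
    at [w] that has not had its turn goes into [S]. The second half of the
    invariant makes each move decrease [S]; the first half is preserved because
    chords do not cross and are met at [w] in their cyclic order. *)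
Lemma walk_invariant v t : (t <= n)%N ->
  let u := (v - Zp1)%R in let w := walk v t in
  (forall (a : 'I_n) x y, ends (c a) x y -> ((u - x)%R < (u - w)%R)%N ->
      ((u - w)%R <= (u - y)%R)%N -> y = w /\ (t <= a)%N) /\
  (forall (a : 'I_n) x, ends (c a) w x -> (t <= a)%N -> ((u - x)%R < (u - w)%R)%N).
Proof.
move=> tn u; elim: t tn => [_|t IHt tn].
  rewrite /walk take0 /= /u.
  have dv : ((v - Zp1 - v)%R : nat) = n.
    rewrite addrAC subrr add0r /=; case: (n) => [|m]; first by rewrite !modn1.
    by rewrite (modn_small (m := 1)) // modn_small ?subn1.
  have small (x : V) : x != v -> ((v - Zp1 - x)%R < (v - Zp1 - v)%R)%N.
    have le_n : ((v - Zp1 - x)%R <= n)%N by rewrite -ltnS ltn_ord.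
    move=> nx; rewrite dv ltn_neqAle le_n andbT; apply: contra nx => /eqP dx.
    by apply/eqP/oppr_inj/(addrI (v - Zp1))/val_inj; apply: etrans dx (esym dv).
  split=> [a x y e _ le_y|a x e _]; last by apply: small; rewrite eq_sym (ends_neq exc e).
  by split=> //; apply/eqP; apply: contraTT le_y => /small; rewrite -ltnNge.
have [] := IHt (ltnW tn); set w := walk v t => inv1 inv2.
rewrite (walkS v (Ordinal tn)) -/w; set a0 := Ordinal tn.
have [[-> noe]|[x0 e0]] := ends_spec a0 w.
  (* The chord number [t] does not touch [w]: nothing moves. *)
  have shift (a : 'I_n) x : ends (c a) w x -> (t <= a)%N -> (t < a)%N.
    move=> e; rewrite leq_eqVlt => /orP[/eqP ta|//].
    have aE : a0 = a by apply/val_inj.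
    by rewrite -aE in e; rewrite (negPf (noe x)) in e.
  split=> [a x y e lt_x le_y|a x e lt_a]; last by apply: inv2 e _; apply: ltnW.
  have [yw lt_a] := inv1 _ _ _ e lt_x le_y; split=> //.
  by apply: shift lt_a; rewrite -yw endsC; exact: e.
rewrite (tperm_ends e0).
have lt0 := inv2 _ _ e0 (leqnn t).
have ltS (a : 'I_n) : a0 != a -> (t <= a)%N -> (t < a)%N.
  by rewrite -val_eqE /=; lia.
split=> [a y z e lt_y le_z|a z e lt_a].
  have nyx : y != x0 by apply: contraTneq lt_y => ->; rewrite ltnn.
  have [lt_z|le_wz] := ltnP (u - z)%R (u - w)%R; last first.
    have [zw le_a] := inv1 _ _ _ e (ltn_trans lt_y lt0) le_wz.
    have na0 : a0 != a.
      apply/eqP=> ea; move: nyx; rewrite zw endsC -ea in e.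
      by rewrite (ends_other exc e e0) eqxx.
    have e' : ends (c a) w y by rewrite endsC -zw.
    (* The chord from [w] to [y] would come after the one from [w] to [x0],
       but [y] is nearer to [u] than [x0]. *)
    have := cyclic_order e0 e' (ltS _ na0 le_a).
    by rewrite ltnNge ltnW // (turn_lt lt_y).
  have [zx|nzx] := eqVneq z x0.
    split=> //; have na0 : a0 != a.
      apply/eqP=> ea; move: e e0; rewrite -ea zx endsC => e1; rewrite endsC => e2.
      by move: lt_y lt0; rewrite (ends_other exc e1 e2); lia.
    have e1 : ends (c a) x0 y by rewrite endsC -zx.
    have e2 : ends (c a0) x0 w by rewrite endsC.
    have lt_turn := turn_gt lt_y lt0; rewrite ltnNge; apply/negP=> le_a.
    have lt_a : (a < a0)%N by move: na0; rewrite -val_eqE /=; lia.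
    by have := cyclic_order e1 e2 lt_a; rewrite ltnNge ltnW.
  have lt_xz : ((u - x0)%R < (u - z)%R)%N.
    rewrite ltn_neqAle le_z andbT; apply: contra nzx.
    by move=> /eqP/val_inj/(addrI u)/oppr_inj ->.
  rewrite endsC in e0.
  by case: (noncrossing_cyclic e0 e lt_y lt_xz lt_z).
rewrite endsC in e0.
have na0 : a0 != a by rewrite -val_eqE /=; lia.
have nzw : z != w.
  by apply: contra na0 => /eqP zw; rewrite zw in e; rewrite (ends_inj exc e0 e).
have lt_turn := cyclic_order e0 e lt_a.
rewrite ltnNge; apply/negP=> le_z.
have [le_wz|lt_wz] := leqP (u - w)%R (u - z)%R.
  by have [] := inv1 _ _ _ e lt0 le_wz => zw; rewrite zw eqxx in nzw.
by rewrite ltnNge ltnW ?(turn_le le_z) in lt_turn.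
Qed.

(** When all chords have had their turn, no chord leaves the region [S] of
    [walk_invariant]. As the chords connect all the vertices, [S] is empty. *)
Lemma walk_end v : walk v n = v - Zp1.
Proof.
have [] := walk_invariant v (leqnn n); set w := walk v n; set u := v - Zp1 => inv _.
pose P x := ((u - x)%R < (u - w)%R)%N.
have /chords_connected Pc : forall a, P (c a).1 = P (c a).2.
  have half (a : 'I_n) x y : ends (c a) x y -> P x -> P y.
    move=> e Px; rewrite /P ltnNge; apply/negP=> le_y.
    by have [_] := inv _ _ _ e Px le_y; rewrite leqNgt ltn_ord.
  move=> a; apply/idP/idP; apply: (half a); rewrite /ends -surjective_pairing eqxx ?orbT //.
have := Pc u w; rewrite {2}/P ltnn /P => /negbT; rewrite subrr -leqNgt leqn0.
by move=> /eqP uw0; have /eqP : u - w = 0 by [apply/val_inj]; rewrite subr_eq0 => /eqP.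
Qed.

End Connected.

(** * Rotations and relation-preserving bijections *)

Section Rotation.
Variable n : nat.
Notation V := 'I_n.+1.
Implicit Types c : 'I_n -> V * V.

Definition chord_tree c : {set {set V}} := [set [set (c a).1; (c a).2] | a : 'I_n].

Lemma ordSE (x : V) : ordS x = x + Zp1.
Proof. by apply/val_inj; rewrite /= modnDmr addn1. Qed.

Lemma iter_rotation m c :
  iter m (@rotation n) (chord_tree c) =
  [set [set (c a).1 + Zp1 *+ m; (c a).2 + Zp1 *+ m] | a : 'I_n].
Proof.
elim: m => [|m IHm] /=.
  by apply: eq_imset => a; rewrite !addr0.
rewrite IHm /rotation -imset_comp; apply: eq_imset => a /=.
by rewrite imsetU1 imset_set1 !ordSE -!addrA -!mulrSr.
Qed.

Lemma ends_set2 c a x y : exceptional_intervals c ->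
  ends (c a) x y <-> [set (c a).1; (c a).2] = [set x; y].
Proof.
move=> exc; split=> [/orP[]/eqP-> //=|eqs]; first by rewrite setUC.
have := interval_lt exc a.
have : (c a).1 \in [set x; y] by rewrite -eqs !inE eqxx.
have : (c a).2 \in [set x; y] by rewrite -eqs !inE eqxx orbT.
rewrite !inE /ends [c a]surjective_pairing !xpair_eqE /=.
by move=> /orP[]/eqP-> /orP[]/eqP->; rewrite ?ltnn ?eqxx ?orbT.
Qed.

(** The hypothesis on [psi] says that it is a rotation. *)
Lemma turn_invariant c c' (phi : 'I_n -> 'I_n) (psi : V -> V) :
  exceptional_intervals c -> exceptional_intervals c' -> injective phi ->
  (forall x y, psi x - psi y = x - y) ->
  (forall a x y, ends (c a) x y -> ends (c' (phi a)) (psi x) (psi y)) ->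
  forall a b, arrow_rel (c a) (c b) = arrow_rel (c' (phi a)) (c' (phi b)).
Proof.
move=> exc exc' phi_inj psiB endsM a b.
have [->|nab] := eqVneq a b; first by rewrite !arrow_rel_refl.
have nab' : phi a != phi b by rewrite (inj_eq phi_inj).
have key v x y : ends (c a) v x -> ends (c b) v y ->
    arrow_rel (c a) (c b) = arrow_rel (c' (phi a)) (c' (phi b)).
  move=> ea eb; rewrite (arrow_rel_turn exc ea eb) //.
  by rewrite (arrow_rel_turn exc' (endsM _ _ _ ea) (endsM _ _ _ eb)) // !psiB.
apply/idP/idP=> ab.
  by have [v [x [y [ea eb]]]] := arrow_rel_share exc ab nab; rewrite -(key v x y).
have [v [x [y [ea eb]]]] := arrow_rel_share exc' ab nab'.
have psi_inj : injective psi.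
  by move=> x' y' e; apply/eqP; rewrite -subr_eq0 -psiB e subrr.
have [psi' psiK psi'K] := injF_bij psi_inj.
have endsM' d x' y' : ends (c' (phi d)) x' y' -> ends (c d) (psi' x') (psi' y').
  move=> e; have e1 : ends (c d) (c d).1 (c d).2 by rewrite /ends -surjective_pairing eqxx.
  have e2 := endsM _ _ _ e1; have := ends_neq exc' e.
  move: e e2; rewrite /ends => /orP[]/eqP-> /orP[]/eqP[-> ->];
    rewrite !psiK -?surjective_pairing ?eqxx ?orbT //.
by rewrite (key _ _ _ (endsM' _ _ _ ea) (endsM' _ _ _ eb)).
Qed.

Lemma rotated_trees c c' m : exceptional_intervals c -> exceptional_intervals c' ->
  chord_tree c' = iter m (@rotation n) (chord_tree c) ->
  exists2 phi : 'I_n -> 'I_n, injective phi &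
    forall a b, arrow_rel (c a) (c b) = arrow_rel (c' (phi a)) (c' (phi b)).
Proof.
move=> exc exc'; rewrite iter_rotation => eqT.
have /choice[phi phiP] (a : 'I_n) :
    exists b, ends (c' b) ((c a).1 + Zp1 *+ m) ((c a).2 + Zp1 *+ m).
  have /imsetP[b _ /esym/ends_set2 e] :
      [set (c a).1 + Zp1 *+ m; (c a).2 + Zp1 *+ m] \in chord_tree c'.
    by rewrite eqT; apply/imsetP; exists a.
  by exists b; apply: e.
have endsM a x y : ends (c a) x y -> ends (c' (phi a)) (x + Zp1 *+ m) (y + Zp1 *+ m).
  move=> e; have := phiP a; move: e => /orP[]/eqP -> //=.
  by rewrite endsC.
have phi_inj : injective phi.
  move=> a b eab; apply: (interval_inj exc).
  have := phiP b; rewrite -eab; have := phiP a.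
  have := interval_lt exc a; have := interval_lt exc b.
  rewrite (surjective_pairing (c a)) (surjective_pairing (c b)) /=.
  have cancel (x y : V) : x + Zp1 *+ m = y + Zp1 *+ m -> x = y by move=> /addIr.
  move=> ltb lta /orP[]/eqP -> ; rewrite /ends !xpair_eqE
    => /orP[]/andP[/eqP/cancel e1 /eqP/cancel e2].
  - by rewrite e1 e2.
  - by move: lta ltb; rewrite e1 e2; lia.
  - by move: lta ltb; rewrite e1 e2; lia.
  by rewrite e1 e2.
exists phi => //; apply: (turn_invariant (psi := fun x => x + Zp1 *+ m)) => // x y.
by rewrite opprD addrACA subrr addr0.
Qed.

Definition endpoint c a (x : V) := (x == (c a).1) || (x == (c a).2).

Section Vertices.
Variable c : 'I_n -> V * V.
Hypothesis exc : exceptional_intervals c.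

Definition adjacent a b := (a != b) && (arrow_rel (c a) (c b) || arrow_rel (c b) (c a)).

Lemma adjacentC a b : adjacent a b = adjacent b a.
Proof. by rewrite /adjacent eq_sym orbC. Qed.

Lemma endpointP a x : reflect (exists y, ends (c a) x y) (endpoint c a x).
Proof.
apply: (iffP orP) => [[]/eqP->|[y /orP[]/eqP->]]; last by right.
- by exists (c a).2; rewrite /ends -surjective_pairing eqxx.
- by exists (c a).1; rewrite /ends -surjective_pairing eqxx orbT.
by left.
Qed.

Lemma endpoint_ends a x y : endpoint c a x -> endpoint c a y -> x != y -> ends (c a) x y.
Proof.
rewrite /endpoint /ends (surjective_pairing (c a)).
by move=> /orP[]/eqP-> /orP[]/eqP->; rewrite !eqxx ?orbT.
Qed.

Lemma ends_endpoint a x y : ends (c a) x y -> endpoint c a x && endpoint c a y.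
Proof. by rewrite /endpoint => /orP[]/eqP->; rewrite !eqxx ?orbT. Qed.

Lemma endpoint_inj a b x y :
  endpoint c a x -> endpoint c a y -> endpoint c b x -> endpoint c b y -> x != y -> a = b.
Proof.
by move=> ax ay bx b_y xy; apply: (ends_inj exc (x := x) (y := y)); apply: endpoint_ends.
Qed.

Lemma adjacentP a b : reflect (a != b /\ exists x, endpoint c a x && endpoint c b x) (adjacent a b).
Proof.
apply: (iffP andP) => -[nab ab]; split=> //.
  have [/(arrow_rel_share exc)|/(arrow_rel_share exc)] := orP ab.
    move=> /(_ nab)[v [x [y [/ends_endpoint/andP[av _] /ends_endpoint/andP[bv _]]]]].
    by exists v; rewrite av.
  rewrite eq_sym => /(_ nab)[v [x [y [/ends_endpoint/andP[av _] /ends_endpoint/andP[bv _]]]]].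
  by exists v; rewrite av bv.
case: ab => v /andP[/endpointP[x ea] /endpointP[y eb]].
rewrite (arrow_rel_turn exc ea eb nab) (arrow_rel_turn exc eb ea) 1?eq_sym //.
case: ltngtP => // /val_inj/(addrI v)/oppr_inj xy.
by case/eqP: nab; apply: (ends_inj exc ea); rewrite xy.
Qed.

(** The line graph of a tree: triangles in it come from chords with a common
    endpoint. *)
Lemma clique_common a b d x : adjacent a b -> adjacent a d -> adjacent b d ->
  endpoint c a x -> endpoint c b x -> endpoint c d x.
Proof.
move=> /andP[nab _] /adjacentP[nad [y /andP[ay dy]]] /adjacentP[nbd [z /andP[bz dz]]] ax bx.
have [->//|nxy] := eqVneq x y; have [->//|nxz] := eqVneq x z.
have [yz|nyz] := eqVneq y z.
  by rewrite -yz in bz; case/eqP: nab; apply: endpoint_inj ax ay bx bz nxy.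
case: (@no_triangle _ _ exc a d b x y z); apply: endpoint_ends => //; by rewrite eq_sym.
Qed.

Hypothesis n_ge2 : (2 <= n)%N.

Lemma neighbour a : exists b, adjacent a b.
Proof.
have [b nab] : exists b : 'I_n, a != b.
  case: (eqVneq a (Ordinal (ltnW n_ge2))) => [->|na].
    by exists (Ordinal n_ge2).
  by exists (Ordinal (ltnW n_ge2)).
apply/existsP; apply: contraT; rewrite negb_exists => /forallP no_b.
have far d x : a != d -> endpoint c a x -> endpoint c d x = false.
  move=> nad ax; apply/negP=> dx; have /negP[] := no_b d; apply/adjacentP.
  by split=> //; exists x; rewrite ax.
have on1 d : endpoint c d (c d).1 by rewrite /endpoint eqxx.
have on2 d : endpoint c d (c d).2 by rewrite /endpoint eqxx orbT.
have closed d : endpoint c a (c d).1 = endpoint c a (c d).2.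
  have [<-|nad] := eqVneq a d; first by rewrite on1 on2.
  apply/idP/idP=> /(far d _ nad).
    by rewrite on1.
  by rewrite on2.
have := chords_connected exc closed (c a).1 (c b).1; rewrite on1 => /esym/(far b _ nab).
by rewrite on1.
Qed.

Lemma endpoint_exists x : exists a, endpoint c a x.
Proof.
apply/existsP; apply: contraT; rewrite negb_exists => /forallP no_a.
have closed d : pred1 x (c d).1 = pred1 x (c d).2.
  have := no_a d; rewrite /endpoint negb_or /= => /andP[].
  by rewrite ![x == _]eq_sym => /negPf -> /negPf ->.
pose a := Ordinal (ltnW n_ge2).
have := chords_connected exc closed x (c a).1; rewrite /= eqxx => /esym/eqP ex.
by have := no_a a; rewrite /endpoint ex eqxx.
Qed.
End Vertices.

Section Reconstruction.
Variables c c' : 'I_n -> V * V.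
Hypotheses (exc : exceptional_intervals c) (exc' : exceptional_intervals c').
Hypothesis n_ge2 : (2 <= n)%N.
Variable phi : 'I_n -> 'I_n.
Hypothesis phi_inj : injective phi.
Hypothesis phiR : forall a b, arrow_rel (c a) (c b) = arrow_rel (c' (phi a)) (c' (phi b)).

Lemma phi_adjacent a b : adjacent c' (phi a) (phi b) = adjacent c a b.
Proof. by rewrite /adjacent (inj_eq phi_inj) -!phiR. Qed.

(** If several chords meet at [x], then [x'] is the common endpoint of the images
    of two of them, and [clique_common] takes care of the others. If a single
    chord [a] ends at [x], then a chord [b] meets [a] at its other end, and [x']
    is the end of the image of [a] that is not on the image of [b]; any other
    chord whose image passes through [x'] would meet [a] and [b], and the three
    images would form a triangle. *)
Lemma vertex_image x : exists x', forall d, endpoint c d x = endpoint c' (phi d) x'.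
Proof.
have meet a b y : a != b -> endpoint c a y -> endpoint c b y -> adjacent c a b.
  by move=> nab ay b_y; apply/(adjacentP exc); split=> //; exists y; rewrite ay.
have meet' a b y : a != b -> endpoint c' (phi a) y -> endpoint c' (phi b) y -> adjacent c a b.
  move=> nab ay b_y; rewrite -phi_adjacent; apply/(adjacentP exc').
  by rewrite (inj_eq phi_inj); split=> //; exists y; rewrite ay.
have [a ax] := endpoint_exists exc n_ge2 x.
suff [x' ax' dx'] : exists2 x', endpoint c' (phi a) x' &
    forall d, a != d -> endpoint c d x = endpoint c' (phi d) x'.
  by exists x' => d; have [<-|/dx'//] := eqVneq a d; rewrite ax ax'.
have [/existsP[b /andP[nab bx]]|] := boolP [exists b, (a != b) && endpoint c b x].
  have ab := meet _ _ _ nab ax bx.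
  have /(adjacentP exc')[_ [x' /andP[ax' bx']]] : adjacent c' (phi a) (phi b).
    by rewrite phi_adjacent.
  exists x' => // d nad; have [<-|nbd] := eqVneq b d; first by rewrite bx.
  apply/idP/idP=> dx.
    apply: (clique_common exc' _ _ _ ax' bx'); rewrite phi_adjacent //.
      exact: meet ax dx.
    exact: meet bx dx.
  by apply: (clique_common exc ab _ _ ax bx); [apply: meet' ax' dx | apply: meet' bx' dx].
rewrite negb_exists => /forallP leaf.
have {}leaf d : a != d -> endpoint c d x = false.
  by move=> nad; have := leaf d; rewrite nad => /negPf.
have [b ab] := neighbour exc n_ge2 a; have /(adjacentP exc)[nab [y /andP[ay b_y]]] := ab.
have /(adjacentP exc')[_ [y' /andP[ay' by']]] : adjacent c' (phi a) (phi b).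
  by rewrite phi_adjacent.
have [x' ex'] := endpointP _ _ _ ay'; have /andP[_ ax'] := ends_endpoint ex'.
have nyx' := ends_neq exc' ex'.
(* Otherwise the images of [a] and [b] would have the same two endpoints. *)
have bx' : endpoint c' (phi b) x' = false.
  apply/negP=> bx'; case/eqP: nab; apply: phi_inj.
  exact: (endpoint_inj exc' ay' ax' by' bx' nyx').
exists x' => // d nad; rewrite leaf //; apply/esym/negP=> dx'.
have ad := meet' _ _ _ nad ax' dx'.
have nbd : b != d by apply: contraFneq bx' => ->.
have /(adjacentP exc)[_ [z /andP[az dz]]] := ad.
have nxz : x != z by apply: contraTneq dz => <-; rewrite leaf.
have nxy : x != y by apply: contraTneq b_y => <-; rewrite leaf.
have zy : z = y by apply: (ends_other exc (endpoint_ends ax az nxz) (endpoint_ends ax ay nxy)).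
rewrite zy in dz; have bd := meet _ _ _ nbd b_y dz.
have := clique_common exc' (a := phi a) (b := phi d) (d := phi b) (x := x').
by rewrite !phi_adjacent ab ad adjacentC bd bx' => /(_ isT isT isT ax' dx').
Qed.

(** Reindexed by [phi], the second family is again in exceptional order, so the
    walks of both families end one step below their starting points, while
    [psi] carries the walks of the first family to those of the second. Hence
    [psi] commutes with the long cycle. *)
Lemma recover_rotation :
  exists m, chord_tree c' = iter m (@rotation n) (chord_tree c).
Proof.
have [psi psiP] := choice vertex_image.
have psi_inj : injective psi.
  move=> x y exy; have onxy d : endpoint c d x = endpoint c d y by rewrite psiP exy -psiP.
  have [a ax] := endpoint_exists exc n_ge2 x; have [b] := neighbour exc n_ge2 a.
  have ay : endpoint c a y by rewrite -onxy.
  move=> /(adjacentP exc)[nab [z /andP[az bz]]].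
  apply/eqP; apply: contraTT bz => nxy; apply/negP=> bz.
  have zxy : z = x \/ z = y.
    have [|nzx] := eqVneq x z; first by left.
    right; apply: (ends_other exc (endpoint_ends ax az nzx) (endpoint_ends ax ay nxy)).
  have bx : endpoint c b x by case: zxy bz => ->; rewrite ?onxy.
  have b_y : endpoint c b y by rewrite -onxy.
  by case/eqP: nab; apply: (endpoint_inj exc ax ay bx b_y nxy).
have endsM a x y : ends (c a) x y -> ends (c' (phi a)) (psi x) (psi y).
  move=> e; have /andP[ax ay] := ends_endpoint e; apply: endpoint_ends; rewrite -?psiP //.
  by rewrite (inj_eq psi_inj) (ends_neq exc e).
(* The second family, listed in the order of the first one. *)
pose c2 a := c' (phi a).
have exc2 : exceptional_intervals c2.
  split=> [a|a b lt_ba]; first exact: (interval_lt exc').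
  by rewrite -phiR; apply: (proj2 exc).
have walkM v t : (t <= n)%N -> walk c2 (psi v) t = psi (walk c v t).
  elim: t => [|t IHt] tn; first by rewrite /walk !take0.
  rewrite (walkS c2 _ (Ordinal tn)) (walkS c _ (Ordinal tn)) /= (IHt (ltnW tn)).
  set a := Ordinal tn; set w := walk c v t.
  have [[-> now]|[x e]] := ends_spec c a w; last first.
    by rewrite (tperm_ends e) (tperm_ends (endsM _ _ _ e)).
  have [[-> //]|[x /ends_endpoint/andP[]]] := ends_spec c2 a (psi w).
  rewrite -[endpoint _ _ _](psiP w a) => /endpointP[y e] _.
  by have := now y; rewrite e.
have psi1 v : psi (v - Zp1) = psi v - Zp1.
  by rewrite -(walk_end exc v) -(walk_end exc2 (psi v)) walkM.
have psim m v : psi (v - Zp1 *+ m) = psi v - Zp1 *+ m.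
  elim: m v => [|m IHm] v; first by rewrite !subr0.
  by rewrite mulrSr opprD !addrA psi1 IHm.
have natV (x : V) : Zp1 *+ val x = x.
  by apply/val_inj; rewrite Zp_mulrn /= modnMml mul1n modn_small.
have psiE x : psi x = x + psi 0.
  by rewrite -{1}[x]opprK -[- x]natV -[X in psi X]add0r psim natV opprK addrC.
exists (val (psi 0)); rewrite iter_rotation natV.
have [phi' phiK phi'K] := injF_bij phi_inj.
apply/setP=> e; apply/imsetP/imsetP=> -[a _ ->].
  exists (phi' a) => //; rewrite -!psiE; apply/(ends_set2 _ _ _ exc').
  rewrite -[a in ends (c' a)]phi'K; apply: endsM; rewrite /ends -surjective_pairing eqxx //.
exists (phi a) => //; rewrite -!psiE; apply/esym/(ends_set2 _ _ _ exc').
by apply: endsM; rewrite /ends -surjective_pairing eqxx.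
Qed.
End Reconstruction.
End Rotation.

(** * Hom and Ext between interval modules *)

Section EntrySum.
Variable k : fieldType.

(** Between interval modules all matrices have at most one row and one column.
    The sum of the entries is then an injective and multiplicative way of
    reading such a matrix as a scalar, for every value of the dimensions. *)
Definition entry_sum m p (M : 'M[k]_(m, p)) : k := \sum_i \sum_j M i j.

Lemma entry_sumB m p (M N : 'M[k]_(m, p)) : entry_sum (M - N) = entry_sum M - entry_sum N.
Proof.
rewrite /entry_sum -sumrB; apply: eq_bigr => i _; rewrite -sumrB.
by apply: eq_bigr => j _; rewrite !mxE.
Qed.

Lemma entry_sumZ m p x (M : 'M[k]_(m, p)) : entry_sum (x *: M) = x * entry_sum M.
Proof.
rewrite /entry_sum mulr_sumr; apply: eq_bigr => i _; rewrite mulr_sumr.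
by apply: eq_bigr => j _; rewrite !mxE.
Qed.

Lemma entry_sum_eq0 (b1 b2 : bool) (M : 'M[k]_(b1, b2)) : ~~ (b1 && b2) -> entry_sum M = 0.
Proof.
case: b1 b2 M => [] [] M // _; rewrite /entry_sum ?big_ord0 //.
by rewrite big1 // => i _; rewrite big_ord0.
Qed.

Lemma entry_sumM (b1 b2 b3 : bool) (M : 'M[k]_(b1, b2)) (N : 'M[k]_(b2, b3)) :
  entry_sum (M *m N) = entry_sum M * entry_sum N.
Proof.
have [b13|nb13] := boolP (b1 && b3); last first.
  rewrite (entry_sum_eq0 _ nb13); move: nb13; rewrite negb_and => /orP[] /negPf b0.
    by rewrite (entry_sum_eq0 M) ?mul0r // b0.
  by rewrite (entry_sum_eq0 N) ?mulr0 // b0 andbF.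
case/andP: b13 M N => -> -> M N; case: b2 M N => M N.
  by rewrite /entry_sum !big_ord1 mxE big_ord1.
by rewrite (entry_sum_eq0 M) // mul0r /entry_sum !big_ord1 mxE big_ord0.
Qed.

Lemma entry_sum_const (b1 b2 : bool) x :
  entry_sum (const_mx x : 'M[k]_(b1, b2)) = if b1 && b2 then x else 0.
Proof.
case: ifP => [/andP[-> ->]|/negbT]; last exact: entry_sum_eq0.
by rewrite /entry_sum !big_ord1 mxE.
Qed.

Lemma entry_sum_inj (b1 b2 : bool) : injective (@entry_sum b1 b2).
Proof.
move=> M N; case: b1 b2 M N => [] [] M N; rewrite /entry_sum ?big_ord1 => eMN; apply/matrixP=> i j.
- by rewrite !ord1.
- by case: j.
- by case: i.
- by case: i.
Qed.
End EntrySum.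

Section ZeroProducts.
Variables (k : fieldType) (W : finType) (Q : quiver W) (L M N : rep k Q).

Lemma ext_pull0 (f : hom L M) : ext_pull f (0 : ext M N) = 0.
Proof. by rewrite -(scale0r 0) ext_pullZr scale0r. Qed.

Lemma ext_push0 (f : hom M N) : ext_push (0 : ext L M) f = 0.
Proof. by rewrite -(scale0r 0) ext_pushZl scale0r. Qed.

Lemma hom_comp0r (f : hom L M) : hom_comp f (0 : hom M N) = 0.
Proof. by rewrite -(scale0r 0) hom_compZr scale0r. Qed.

Lemma hom_comp0l (f : hom M N) : hom_comp (0 : hom L M) f = 0.
Proof. by rewrite -(scale0r 0) hom_compZl scale0r. Qed.
End ZeroProducts.

Section IntervalModules.
Variables (k : fieldType) (n : nat).
Notation V := 'I_n.+1.
Implicit Types c d : V * V.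

Definition inside c (v : nat) := (c.1 <= v < c.2)%N.
Definition chord_module c : rep k (linear_quiver n) := interval_module k c.1 c.2.

Section Cochains.
Variables c d : V * V.

(** Cochains between interval modules as scalar functions on all natural numbers,
    zero outside the vertices or arrows where both modules live. *)
Definition value0 (f : cochain0 (chord_module c) (chord_module d)) (v : nat) : k :=
  if insub v is Some v' then entry_sum (f v') else 0.
Definition value1 (e : cochain1 (chord_module c) (chord_module d)) (a : nat) : k :=
  if insub a is Some a' then entry_sum (e a') else 0.

Lemma value0_ord f (v : 'I_n) : value0 f v = entry_sum (f v).
Proof. by rewrite /value0 valK. Qed.
Lemma value1_ord e (a : 'I_n.-1) : value1 e a = entry_sum (e a).
Proof. by rewrite /value1 valK. Qed.

Lemma value0_out f v : ~~ (inside c v && inside d v) -> value0 f v = 0.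
Proof.
rewrite /value0; case: insubP => //= v' _ <-;
exact: (@entry_sum_eq0 k (inside c v') (inside d v')).
Qed.
Lemma value1_out e a : ~~ (inside c a && inside d a.+1) -> value1 e a = 0.
Proof.
rewrite /value1; case: insubP => //= a' _ <-;
exact: (@entry_sum_eq0 k (inside c a') (inside d a'.+1)).
Qed.

Lemma value0_inj f g : value0 f =1 value0 g -> f = g.
Proof.
move=> efg; apply/ffunP=> v; apply: (@entry_sum_inj k (inside c v) (inside d v)).
by have := efg v; rewrite !value0_ord.
Qed.
Lemma value1_inj e e' : value1 e =1 value1 e' -> e = e'.
Proof.
move=> ee'; apply/ffunP=> a; apply: (@entry_sum_inj k (inside c a) (inside d a.+1)).
by have := ee' a; rewrite !value1_ord.
Qed.

Definition cochain0_of (F : nat -> k) : cochain0 (chord_module c) (chord_module d) :=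
  [ffun v : 'I_n => const_mx (F v)].
Definition cochain1_of (F : nat -> k) : cochain1 (chord_module c) (chord_module d) :=
  [ffun a : arr (linear_quiver n) => const_mx (F (a : 'I_n.-1))].

Lemma inside_lt (b : V * V) v : inside b v -> (v < n)%N.
Proof. by move=> /andP[_]; have := ltn_ord b.2; lia. Qed.

Lemma value0_mk F (v : nat) :
  value0 (cochain0_of F) v = if inside c v && inside d v then F v else 0.
Proof.
case: ifP => [|/negbT/value0_out //] /andP[cv dv].
have lt_v := inside_lt cv; rewrite (value0_ord _ (Ordinal lt_v)) ffunE.
by rewrite (@entry_sum_const k (inside c v) (inside d v)) cv dv.
Qed.
Lemma value1_mk F (a : nat) :
  value1 (cochain1_of F) a = if inside c a && inside d a.+1 then F a else 0.
Proof.
case: ifP => [|/negbT/value1_out //] /andP[cv dv].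
have lt_a : (a < n.-1)%N by have := inside_lt dv; lia.
rewrite (value1_ord _ (Ordinal lt_a)) ffunE.
by rewrite (@entry_sum_const k (inside c a) (inside d a.+1)) cv dv.
Qed.

Lemma value0Z x f v : value0 (x *: f) v = x * value0 f v.
Proof. by rewrite /value0; case: insub => [v'|]; rewrite ?mulr0 // dffunZE entry_sumZ. Qed.
Lemma value1Z x f v : value1 (x *: f) v = x * value1 f v.
Proof. by rewrite /value1; case: insub => [v'|]; rewrite ?mulr0 // dffunZE entry_sumZ. Qed.
Lemma value1B e e' a : value1 (e - e') a = value1 e a - value1 e' a.
Proof. by rewrite /value1; case: insub => [v'|]; rewrite ?subr0 // dffunDE dffunNE entry_sumB. Qed.
Lemma value0_0 v : value0 0 v = 0.
Proof. by rewrite -(scale0r 0) value0Z mul0r. Qed.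

Lemma value1_diff f a : value1 (diff f) a =
  if inside c a && inside d a.+1 then value0 f a - value0 f a.+1 else 0.
Proof.
case: ifP => [|/negbT/value1_out //] /andP[ca da].
have lt_a : (a < n.-1)%N by have := inside_lt da; lia.
pose a' := Ordinal lt_a; rewrite (value1_ord _ a') ffunE entry_sumB.
rewrite (@entry_sumM k (inside c a) (inside d a) (inside d a.+1)).
rewrite (@entry_sumM k (inside c a) (inside c a.+1) (inside d a.+1)).
rewrite (@entry_sum_const k (inside d a) (inside d a.+1)).
rewrite (@entry_sum_const k (inside c a) (inside c a.+1)).
rewrite -(value0_ord f (src (a' : arr (linear_quiver n)))).
rewrite -(value0_ord f (tgt (a' : arr (linear_quiver n)))) /=.
rewrite ca da andbT /=; congr (_ - _).
  case: ifP => da1; first by rewrite mulr1.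
  by rewrite mulr0 value0_out ?da1 ?andbF.
case: ifP => ca1; first by rewrite mul1r.
by rewrite mul0r value0_out ?ca1.
Qed.

(** A homomorphism is constant on the common support and on one more vertex, where
    its value is zero, at the left if [c] starts first and at the right if [d]
    ends last. This kills it unless [hom_rel] holds. *)
Lemma hom_constant (f : hom (chord_module c) (chord_module d)) v w : (v <= w)%N ->
  (c.1 <= v)%N -> (d.1 <= v.+1)%N -> (w <= c.2)%N -> (w < d.2)%N ->
  value0 (sval f) v = value0 (sval f) w.
Proof.
move=> vw; rewrite -(subnKC vw); elim: (w - v)%N => [|m IHm]; first by rewrite addn0.
move=> cv dv cw dw; rewrite IHm ?addnS; [|lia..].
have := value1_diff (sval f) (v + m); have := valP f; rewrite inE => /eqP ->.
have -> : inside c (v + m) && inside d (v + m).+1 by rewrite /inside; lia.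
move=> /esym/eqP; rewrite -(scale0r 0) value1Z mul0r subr_eq0 => /eqP //.
Qed.

Lemma hom_interval0 (f : hom (chord_module c) (chord_module d)) : ~~ hom_rel c d -> f = 0.
Proof.
move=> nh; apply/val_inj/value0_inj => v; rewrite value0_0.
have [/andP[cv dv]|] := boolP (inside c v && inside d v); last exact: value0_out.
have [cd|dc] := ltnP c.1 d.1.
  rewrite -(@hom_constant f d.1.-1 v) ?value0_out //; rewrite /inside in cv dv *; lia.
rewrite (@hom_constant f v c.2) ?value0_out //; move: nh cv dv; rewrite /hom_rel /inside; lia.
Qed.

(** The value [0] is taken when the constant cochain is not a homomorphism. *)
Definition hom_unit : hom (chord_module c) (chord_module d) := insubd 0 (cochain0_of (fun=> 1)).

Lemma hom_unitE : hom_rel c d -> sval hom_unit = cochain0_of (fun=> 1).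
Proof.
move=> h; rewrite /hom_unit (val_insubd (0 : hom (chord_module c) (chord_module d))).
case: ifP => // /negP[].
rewrite inE; apply/eqP/value1_inj => a; rewrite value1_diff !value0_mk.
rewrite -[X in _ = value1 X _](scale0r 0) value1Z mul0r.
case: ifP => // /andP[ca da].
have -> : inside d a by move: h ca da; rewrite /hom_rel /inside; lia.
have -> : inside c a.+1 by move: h ca da; rewrite /hom_rel /inside; lia.
by rewrite ca da subrr.
Qed.

Lemma hom_interval1 (f : hom (chord_module c) (chord_module d)) : hom_rel c d ->
  f = value0 (sval f) c.1 *: hom_unit.
Proof.
move=> h; apply/val_inj/value0_inj => v; rewrite value0Z /= hom_unitE // value0_mk.
case: ifP => [/andP[cv dv]|/negbT/value0_out->]; last by rewrite mulr0.
rewrite mulr1; symmetry; apply: hom_constant; move: h cv dv; rewrite /hom_rel /inside; lia.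
Qed.

Lemma hom_unit_neq0 : hom_rel c d -> hom_unit != 0.
Proof.
move=> h; apply/eqP=> /(congr1 (fun f => value0 (sval f) c.1)).
rewrite hom_unitE // value0_mk value0_0.
have -> : inside c c.1 && inside d c.1 by move: h; rewrite /hom_rel /inside; lia.
by apply/eqP; rewrite oner_eq0.
Qed.

(** The linear form that detects Ext^1: by [total_diff] and [coboundary_total],
    when [ext_rel] holds its kernel is the space of coboundaries, and otherwise
    every cochain is a coboundary. *)
Definition total (e : cochain1 (chord_module c) (chord_module d)) : k :=
  \sum_(0 <= a < n) value1 e a.

Lemma totalZ x e : total (x *: e) = x * total e.
Proof. by rewrite /total mulr_sumr; apply: eq_bigr => a _; rewrite value1Z. Qed.

(** The sum telescopes between two points outside the common support. *)
Lemma total_diff f : ext_rel c d -> total (diff f) = 0.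
Proof.
move=> ecd; rewrite /total.
under eq_bigr => a _.
  have -> : value1 (diff f) a = - (value0 f a.+1 - value0 f a).
    rewrite value1_diff opprB; case: ifP => // /negbT out.
    by rewrite !value0_out ?subr0 //; move: ecd out; rewrite /ext_rel /inside; lia.
  over.
rewrite sumrN telescope_sumr // !value0_out ?subr0 ?oppr0 //.
  by move: ecd; rewrite /ext_rel /inside; lia.
by have := ltn_ord c.2; rewrite /inside; lia.
Qed.

(** A primitive of [e] along the quiver. The constant of integration can meet a
    boundary condition at one end of the common support; [ext_rel] is the case in
    which there is a condition at both ends. *)
Lemma coboundary_total e : (ext_rel c d -> total e = 0) -> exists f, e = diff f.
Proof.
move=> tot0.
(* With this constant the primitive vanishes just after the last vertex of [c]
   if [d] starts no later than [c], and just before the first vertex of [d]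
   otherwise. *)
pose C := if (d.1 <= c.1)%N then total e else 0.
pose F v := C - \sum_(0 <= w < v) value1 e w.
have FE v : inside c v -> inside d v.+1 ->
    value0 (cochain0_of F) v = F v /\ value0 (cochain0_of F) v.+1 = F v.+1.
  move=> cv dv; rewrite !value0_mk cv dv andbT /=; split; case: ifP => // /negbT out; rewrite /F /C.
    rewrite ifF; last by move: cv dv out; rewrite /inside; lia.
    rewrite big_nat_cond big1 ?subr0 // => w /andP[/andP[_ lt_w] _].
    by rewrite value1_out //; move: cv dv out; rewrite /inside; lia.
  have -> : \sum_(0 <= w < v.+1) value1 e w = total e.
    rewrite /total [RHS](big_cat_nat (n := v.+1)) //=; last exact: inside_lt cv.
    rewrite [X in _ = _ + X]big_nat_cond [X in _ = _ + X]big1 ?addr0 // => w /andP[/andP[le_w _] _].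
    by rewrite value1_out //; move: cv dv out; rewrite /inside; lia.
  case: ifP => dc; first by rewrite subrr.
  by rewrite tot0 ?subrr //; move: cv dv out dc; rewrite /ext_rel /inside; lia.
exists (cochain0_of F); apply: value1_inj => a; rewrite value1_diff.
case: ifP => [/andP[ca da]|/negbT/value1_out//].
have [-> ->] := FE a ca da; rewrite /F big_nat_recr //=.
by rewrite opprB [RHS]addrC addrA subrK addrC addKr.
Qed.

Lemma ext_class_total e e' : total e = total e' -> ext_class e = ext_class e'.
Proof.
move=> tot; have [f ef] : exists f, e - e' = diff f.
  apply: coboundary_total => _; rewrite /total.
  under eq_bigr => a _ do rewrite value1B.
  by rewrite sumrB; apply/eqP; rewrite subr_eq0; apply/eqP.
by apply/ext_classP; exists f; rewrite -ef addrC subrK.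
Qed.

Definition ext_unit : ext (chord_module c) (chord_module d) :=
  ext_class (cochain1_of (fun a => (a.+1 == c.2)%:R)).

Lemma total_delta e m : (0 < m <= n)%N ->
  (forall a, value1 e a = (a.+1 == m)%:R) -> total e = 1.
Proof.
case: m => // m lt_m eE; rewrite /total (eq_bigr _ (fun a _ => eE a)) big_mkord.
rewrite (bigD1 (Ordinal lt_m)) //= eqxx big1 ?addr0 // => a.
by rewrite -val_eqE /= => /negPf; rewrite eqSS => ->.
Qed.

Lemma value1_unit a : ext_rel c d ->
  value1 (cochain1_of (fun a => (a.+1 == c.2)%:R)) a = (a.+1 == c.2)%:R.
Proof.
move=> ecd; rewrite value1_mk; case: ifP => // /negbT out; case: eqP => // ac.
by move: out ecd; rewrite /ext_rel /inside; lia.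
Qed.

Lemma total_unit : ext_rel c d -> total (cochain1_of (fun a => (a.+1 == c.2)%:R)) = 1.
Proof.
move=> ecd; apply: (@total_delta _ c.2) => [|a]; last exact: value1_unit.
by have := ltn_ord c.2; move: ecd; rewrite /ext_rel; lia.
Qed.

Lemma ext_interval0 (x : ext (chord_module c) (chord_module d)) : ~~ ext_rel c d -> x = 0.
Proof.
move=> ne; rewrite -[x]ext_reprK -(raddf0 (@ext_class k _ _ (chord_module c) (chord_module d))).
apply/ext_classP; have [|f ef] := @coboundary_total (ext_repr x); first by rewrite (negPf ne).
by exists f; rewrite add0r.
Qed.

Lemma ext_interval1 (x : ext (chord_module c) (chord_module d)) : ext_rel c d ->
  exists z, x = z *: ext_unit.
Proof.
move=> ecd; exists (total (ext_repr x)); rewrite -[LHS]ext_reprK /ext_unit -linearZ /=.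
by apply: ext_class_total; rewrite totalZ total_unit ?mulr1.
Qed.

Lemma ext_unit_neq0 : ext_rel c d -> ext_unit != 0.
Proof.
move=> ecd; apply/eqP; rewrite -(raddf0 (@ext_class k _ _ (chord_module c) (chord_module d))).
move=> /ext_classP[f]; rewrite add0r => /(congr1 total).
by rewrite total_diff // total_unit // => /eqP; rewrite oner_eq0.
Qed.

Definition gext_unit : gext (chord_module c) (chord_module d) :=
  if hom_rel c d then (hom_unit, 0) else if ext_rel c d then (0, ext_unit) else 0.

Lemma hom_ext_excl : hom_rel c d -> ~~ ext_rel c d.
Proof. rewrite /hom_rel /ext_rel; lia. Qed.

Lemma gext_unit_span (x : gext (chord_module c) (chord_module d)) : exists z, x = z *: gext_unit.
Proof.
case: x => f x; rewrite /gext_unit; case: ifP => h.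
  exists (value0 (sval f) c.1); rewrite (ext_interval0 x (hom_ext_excl h)).
  by apply: injective_projections; [apply: hom_interval1 | rewrite /= scaler0].
case: ifP => e; last first.
  by exists 0; rewrite (hom_interval0 f (negbT h)) (ext_interval0 x (negbT e)) scaler0.
by have [z ->] := ext_interval1 x e; exists z; rewrite (hom_interval0 f (negbT h));
  apply: injective_projections; rewrite /= ?scaler0.
Qed.

Lemma gext_unit_neq0 : (gext_unit != 0) = arrow_rel c d.
Proof.
rewrite /gext_unit /arrow_rel; case: ifP => h.
  by apply/eqP=> -[]; apply/eqP/hom_unit_neq0.
case: ifP => e; last by rewrite eqxx.
by apply/eqP=> -[]; apply/eqP/ext_unit_neq0.
Qed.
End Cochains.

Lemma gext_unit_id c : (c.1 < c.2)%N -> gext_unit c c = gid (chord_module c).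
Proof.
move=> lt_c; have h : hom_rel c c by rewrite /hom_rel !leqnn lt_c.
rewrite /gext_unit h /gid; congr pair; apply/val_inj/value0_inj => v; rewrite /= hom_unitE //.
congr value0; apply/ffunP=> w; rewrite !ffunE; apply/matrixP=> i j; rewrite !mxE.
suff -> : i = j by rewrite eqxx.
apply/val_inj; move: i j => [i lti] [j ltj] /=; move: lti ltj => /=; case: (_ <= _ < _)%N; lia.
Qed.

(** Chords that do not cross are needed to exclude products that land in the
    wrong degree, such as a homomorphism followed by an extension when only Hom
    is nonzero between the extreme terms. *)
Lemma gext_unit_comp c d e : ~~ crossing c d -> ~~ crossing d c -> ~~ crossing d e ->
    ~~ crossing e d -> ~~ crossing c e -> ~~ crossing e c ->
  arrow_rel c d -> arrow_rel d e -> arrow_rel c e ->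
  gcomp (gext_unit c d) (gext_unit d e) = gext_unit c e.
Proof.
rewrite /arrow_rel /gext_unit => x1 x2 x3 x4 x5 x6.
case hcd: (hom_rel c d) => /= ecd; case hde: (hom_rel d e) => /= ede ce.
- have hce : hom_rel c e
    by move: x1 x2 x3 x4 x5 x6 hcd hde ce; rewrite /crossing /hom_rel /ext_rel; lia.
  rewrite hce /gcomp /= ext_pull0 ext_push0 addr0; congr pair.
  apply/val_inj/value0_inj => v; rewrite /= !hom_unitE //=; congr value0.
  apply/ffunP=> w; apply: (@entry_sum_inj k (inside c w) (inside e w)); rewrite !ffunE.
  rewrite (@entry_sumM k (inside c w) (inside d w) (inside e w)).
  rewrite (@entry_sum_const k (inside c w) (inside d w)).
  rewrite (@entry_sum_const k (inside d w) (inside e w)).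
  rewrite (@entry_sum_const k (inside c w) (inside e w)).
  case cw: (inside c w); rewrite /= ?mul0r //.
  case ew: (inside e w); rewrite ?andbT ?andbF ?mulr0 //.
  by have -> : inside d w; rewrite ?mulr1 //;
    move: hcd hde hce cw ew; rewrite /hom_rel /inside; lia.
- have ece : ext_rel c e
    by move: x1 x2 x3 x4 x5 x6 hcd ede ce; rewrite /crossing /hom_rel /ext_rel; lia.
  rewrite ede ece ifF; last by apply/negP=> /hom_ext_excl; rewrite ece.
  rewrite /gcomp /= hom_comp0r ext_push0 addr0; congr pair.
  rewrite /ext_unit ext_pullE; apply: ext_class_total; rewrite total_unit //.
  apply: (@total_delta _ _ _ d.2) => [|a].
    by have := ltn_ord d.2; move: ede; rewrite /ext_rel; lia.
  have [lt_a|ge_a] := ltnP a n.-1; last first.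
    rewrite /value1 insubF; last by lia.
    by case: eqP => // ac; have := ltn_ord e.2; move: ede; rewrite /ext_rel; lia.
  pose a' := Ordinal lt_a; rewrite (value1_ord _ a') ffunE.
  rewrite (@entry_sumM k (inside c a) (inside d a) (inside e a.+1)).
  rewrite -(value0_ord (sval (hom_unit c d)) (src (a' : arr (linear_quiver n)))).
  rewrite -(value1_ord (cochain1_of d e (fun a => (a.+1 == d.2)%:R)) a') /=.
  rewrite value1_unit // hom_unitE // value0_mk; case: eqP => ad; last by rewrite mulr0.
  rewrite mulr1 ifT //; move: hcd ede ece ad; rewrite /hom_rel /ext_rel /inside; lia.
- have ece : ext_rel c e
    by move: x1 x2 x3 x4 x5 x6 ecd hde ce; rewrite /crossing /hom_rel /ext_rel; lia.
  rewrite ecd ece ifF; last by apply/negP=> /hom_ext_excl; rewrite ece.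
  rewrite /gcomp /= hom_comp0l ext_pull0 add0r; congr pair.
  rewrite /ext_unit ext_pushE; apply: ext_class_total; rewrite total_unit //.
  apply: (@total_delta _ _ _ c.2) => [|a].
    by have := ltn_ord c.2; move: ecd; rewrite /ext_rel; lia.
  have [lt_a|ge_a] := ltnP a n.-1; last first.
    rewrite /value1 insubF; last by lia.
    by case: eqP => // ac; have := ltn_ord e.2; move: ece; rewrite /ext_rel; lia.
  pose a' := Ordinal lt_a; rewrite (value1_ord _ a') ffunE.
  rewrite (@entry_sumM k (inside c a) (inside d a.+1) (inside e a.+1)).
  rewrite -(value0_ord (sval (hom_unit d e)) (tgt (a' : arr (linear_quiver n)))).
  rewrite -(value1_ord (cochain1_of c d (fun a => (a.+1 == c.2)%:R)) a') /=.
  rewrite value1_unit // hom_unitE // value0_mk; case: eqP => ad; last by rewrite mul0r.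
  rewrite mul1r ifT //; move: hde ecd ece ad; rewrite /hom_rel /ext_rel /inside; lia.
by move: x1 x2 x3 x4 x5 x6 ecd ede ce; rewrite /crossing /hom_rel /ext_rel; lia.
Qed.
End IntervalModules.

(** * Indecomposable modules are interval modules *)

Section Retracts.
Variables (k : fieldType) (W : finType) (Q : quiver W).
Implicit Types M N L : rep k Q.

Lemma rep_iso_sym M N : rep_iso M N -> rep_iso N M.
Proof. by move=> [f [g [fg gf]]]; exists g, f. Qed.

Lemma rep_iso_trans M N L : rep_iso M N -> rep_iso N L -> rep_iso M L.
Proof.
move=> [f [g [fg gf]]] [f' [g' [fg' gf']]]; exists (hom_comp f f'), (hom_comp g' g); split.
  by rewrite hom_compA -(hom_compA f) fg' hom_comp1r.
by rewrite hom_compA -(hom_compA g') gf hom_comp1r.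
Qed.

Lemma rep_iso_dim M N v : rep_iso M N -> rdim M v = rdim N v.
Proof.
move=> [f [g [fg gf]]]; apply/eqP; rewrite eqn_leq.
have /mulmx1_min -> : sval f v *m sval g v = 1%:M.
  by have := congr1 (fun h : hom M M => sval h v) fg; rewrite /= !ffunE.
have /mulmx1_min -> // : sval g v *m sval f v = 1%:M.
by have := congr1 (fun h : hom N N => sval h v) gf; rewrite /= !ffunE.
Qed.

Lemma idempotent_split m r (p : 'M[k]_(m, r)) (i : 'M_(r, m)) :
  row_free i -> row_full p -> p *m i *m (p *m i) = p *m i -> i *m p = 1%:M.
Proof.
move=> /row_freeP[i' ii'] /row_fullP[p' pp'] pipi.
have : p' *m (p *m i *m (p *m i)) *m i' = i *m p.
  by rewrite !mulmxA pp' mul1mx -!mulmxA ii' mulmx1.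
by rewrite pipi mulmxA pp' mul1mx ii' => <-.
Qed.

(** The idempotent [1 - g f] splits through a representation [K], so that [M] is
    isomorphic to the sum of [N] and [K]; indecomposability makes [K] zero. *)
Lemma indecomposable_retract M N (f : hom N M) (g : hom M N) :
  indecomposable M -> ~ rep_zero N -> hom_comp f g = hom_id N -> hom_comp g f = hom_id M.
Proof.
move=> [_ indM] N0 fg.
have fgE v : sval f v *m sval g v = 1%:M.
  by have := congr1 (fun h : hom N N => sval h v) fg; rewrite /= !ffunE.
pose e v := 1%:M - sval g v *m sval f v.
have fe v : sval f v *m e v = 0 by rewrite mulmxBr mulmx1 mulmxA fgE mul1mx subrr.
have eg v : e v *m sval g v = 0 by rewrite mulmxBl mul1mx -mulmxA fgE mulmx1 subrr.
have ee v : e v *m e v = e v by rewrite {2}/e mulmxBr mulmx1 mulmxA eg mul0mx subr0.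
have [r [i [p [pi ip rE]]]] : exists (r : W -> nat) (i : forall v, 'M[k]_(r v, rdim M v))
    (p : forall v, 'M[k]_(rdim M v, r v)),
    [/\ forall v, p v *m i v = e v, forall v, i v *m p v = 1%:M & forall v, r v = \rank (e v)].
  exists (fun v => \rank (e v)), (fun v => row_base (e v)), (fun v => col_base (e v)).
  split=> // v; first exact: mulmx_base.
  by apply: (idempotent_split (row_base_free _) (col_base_full _)); rewrite mulmx_base ee.
have em (a : arr Q) : e (src a) *m rmap M a = rmap M a *m e (tgt a).
  by rewrite mulmxBl mulmxBr mul1mx mulmx1 -mulmxA homP mulmxA homP mulmxA.
pose K : rep k Q := @Rep k W Q r (fun a => i (src a) *m rmap M a *m p (tgt a)).
pose h0 : cochain0 M (rep_sum N K) := [ffun v => row_mx (sval g v) (p v)].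
pose h0' : cochain0 (rep_sum N K) M := [ffun v => col_mx (sval f v) (i v)].
have h_hom : h0 \in @is_hom _ _ _ M (rep_sum N K).
  rewrite inE; apply/eqP/ffunP=> a; rewrite dffun0E !ffunE /=.
  rewrite mul_row_block mul_mx_row !mulmx0 addr0 add0r homP !mulmxA pi em.
  by rewrite -(mulmxA _ _ (p _)) -pi -mulmxA ip mulmx1 subrr.
have h_hom' : h0' \in @is_hom _ _ _ (rep_sum N K) M.
  rewrite inE; apply/eqP/ffunP=> a; rewrite dffun0E !ffunE /=.
  rewrite mul_block_col mul_col_mx !mul0mx addr0 add0r homP.
  by rewrite -(mulmxA _ (p _)) pi -(mulmxA (i _)) -em mulmxA -pi mulmxA ip mul1mx subrr.
have iso : rep_iso M (rep_sum N K).
  exists (exist (fun h => h \in @is_hom _ _ _ M (rep_sum N K)) h0 h_hom).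
  exists (exist (fun h => h \in @is_hom _ _ _ (rep_sum N K) M) h0' h_hom').
  split; apply/val_inj/ffunP=> v; rewrite !ffunE /=.
    by rewrite mul_row_col pi addrC subrK.
  rewrite mul_col_row fgE ip.
  have -> : sval f v *m p v = 0.
    by rewrite -[LHS]mulmx1 -(ip v) mulmxA -(mulmxA _ (p v)) pi fe mul0mx.
  have -> : i v *m sval g v = 0.
    by rewrite -[LHS]mul1mx -(ip v) -mulmxA (mulmxA (p v)) pi eg mulmx0.
  by rewrite -scalar_mx_block.
have [/N0//|K0] := indM _ _ iso; apply/val_inj/ffunP=> v; rewrite !ffunE.
have /eqP := K0 v; rewrite /= rE mxrank_eq0 subr_eq0 => /eqP //.
Qed.
End Retracts.

Section Classification.
Variables (k : fieldType) (n : nat).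
Local Notation Q := (linear_quiver n).

(** Values propagate along the arrows from [i]; this is how an element at the
    vertex [i] is pushed through a representation. *)
Lemma forward_family (T : 'I_n -> Type) (h : forall a : arr Q, T (src a) -> T (tgt a))
    (y0 : forall v, T v) (i : 'I_n) :
  exists y : forall v, T v, y i = y0 i /\
    forall a : arr Q, (i <= src a)%N -> y (tgt a) = h a (y (src a)).
Proof.
have step m : exists y : forall v, T v, y i = y0 i /\
    forall a : arr Q, (i <= src a)%N -> (a < m)%N -> y (tgt a) = h a (y (src a)).
  elim: m => [|m [y [yi yh]]]; first by exists y0.
  have [lt_m|ge_m] := ltnP m n.-1; last first.
    exists y; split=> // a ia _; apply: yh => //; exact: leq_trans (ltn_ord a) ge_m.
  pose b : arr Q := Ordinal lt_m.
  have [ib|bi] := leqP i (src b); last first.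
    exists y; split=> // a ia lt_a; apply: yh => //; move: bi ia lt_a => /=; lia.
  exists (dfwith y (h b (y (src b)))); split=> [|a ia lt_a].
    by rewrite dfwith_out // -val_eqE /=; move: ib => /=; lia.
  have src_out : dfwith y (h b (y (src b))) (src a) = y (src a).
    by rewrite dfwith_out // -val_eqE /=; move: lt_a; lia.
  rewrite src_out; have [eab|nab] := eqVneq a b; first by rewrite eab dfwith_in.
  rewrite dfwith_out; first by apply: yh => //; move: nab lt_a; rewrite -val_eqE /=; lia.
  by move: nab lt_a; rewrite -!val_eqE /=; lia.
have [y [yi yh]] := step n; exists y; split=> // a ia; apply: yh => //.
by have := ltn_ord a; lia.
Qed.

(** The dual of [forward_family], used for linear forms. *)
Lemma backward_family (T : 'I_n -> Type) (h : forall a : arr Q, T (tgt a) -> T (src a))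
    (y0 : forall v, T v) (j : 'I_n) :
  exists y : forall v, T v, y j = y0 j /\
    forall a : arr Q, (tgt a <= j)%N -> y (src a) = h a (y (tgt a)).
Proof.
have step m : exists y : forall v, T v, y j = y0 j /\
    forall a : arr Q, (tgt a <= j)%N -> (n <= a + m)%N -> y (src a) = h a (y (tgt a)).
  elim: m => [|m [y [yj yh]]].
    by exists y0; split=> // a _; have := ltn_ord a; lia.
  have [lt_m|ge_m] := ltnP (n - m.+1) n.-1; last first.
    exists y; split=> // a aj lt_a; apply: yh => //; have := ltn_ord a; lia.
  pose b : arr Q := Ordinal lt_m.
  have [bj|jb] := leqP (tgt b) j; last first.
    exists y; split=> // a aj lt_a; apply: yh => //; move: jb aj lt_a => /=; lia.
  exists (dfwith y (h b (y (tgt b)))); split=> [|a aj lt_a].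
    by rewrite dfwith_out // -val_eqE /=; move: bj => /=; lia.
  have tgt_out : dfwith y (h b (y (tgt b))) (tgt a) = y (tgt a).
    by rewrite dfwith_out // -val_eqE /=; move: lt_a; lia.
  rewrite tgt_out; have [eab|nab] := eqVneq a b; first by rewrite eab dfwith_in.
  rewrite dfwith_out; first by apply: yh => //; move: nab lt_a; rewrite -val_eqE /=; lia.
  by move: nab lt_a; rewrite -!val_eqE /=; lia.
have [y [yj yh]] := step n; exists y; split=> // a aj; apply: yh => //; exact: leq_addl.
Qed.

Definition chord_of (i j : 'I_n) : 'I_n.+1 * 'I_n.+1 := (widen_ord (leqnSn n) i, lift ord0 j).

(** Let [i] be the first vertex where [M] lives and [j] the last vertex that some
    element at [i] reaches. Such an element spans a submodule isomorphic to an
    interval module, because it dies after [j]. A linear form at [j] that is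
    nonzero on it, pulled back to the earlier vertices, gives a homomorphism in
    the other direction, because [M] is zero before [i]. The interval module is
    thus a retract of [M]. *)
Lemma indecomposable_interval (M : rep k Q) : indecomposable M ->
  exists c : 'I_n.+1 * 'I_n.+1, (c.1 < c.2)%N /\ rep_iso M (chord_module k c).
Proof.
move=> indM; have [M0 _] := indM.
have [v0 v0P] : exists v, rdim M v != 0%N.
  by apply: contrapT => no_v; apply: M0 => v; apply/eqP; apply: contraT => nz; case: no_v; exists v.
case: (@arg_minnP _ v0 (fun v => rdim M v != 0%N) (fun v => v : nat) v0P) => i Mi minM.
pose fam (y : forall v, 'rV[k]_(rdim M v)) :=
  forall a : arr Q, (i <= src a)%N -> y (tgt a) = y (src a) *m rmap M a.
pose P v := `[< exists y, fam y /\ y v != 0 >].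
have Pi : P i.
  have [y [yi fy]] := forward_family (T := fun v => 'rV[k]_(rdim M v))
    (fun a y => y *m rmap M a) (fun v => const_mx 1) i.
  apply/asboolP; exists y; split=> //; rewrite yi; apply/eqP=> /rowP.
  by move: Mi; rewrite -lt0n => Mi /(_ (Ordinal Mi)) /eqP; rewrite !mxE oner_eq0.
case: (@arg_maxnP _ i P (fun v => v : nat) Pi) => j /asboolP[y [fy yj]] maxP.
have le_ij : (i <= j)%N by apply: maxP.
have [phi yphi] : exists phi, y j *m phi = 1%:M.
  by apply/row_freeP; rewrite /row_free rank_rV yj.
(* The values away from [j] are defaults. *)
have [z [zj fz]] := backward_family (T := fun v => 'cV[k]_(rdim M v))
    (fun a z => rmap M a *m z) (fun v => if v =P j is ReflectT e
       then ecast w ('cV[k]_(rdim M w)) (esym e) phi else 0) j.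
have {zj phi yphi} yzj : y j *m z j = 1%:M.
  by rewrite zj; case: eqP => // e; rewrite eq_axiomK /= yphi.
have yz (v : 'I_n) : (i <= v <= j)%N -> y v *m z v = 1%:M.
  move=> /andP[iv vj]; have [m jE] : exists m, (j = v + m :> nat)%N by exists (j - v)%N; lia.
  elim: m v iv vj jE => [|m IHm] v iv vj jE.
    by have -> : v = j by apply/val_inj; rewrite /= jE addn0.
  have lt_v : (v < n.-1)%N by have := ltn_ord j; lia.
  pose a : arr Q := Ordinal lt_v; have va : v = src a by apply/val_inj.
  rewrite va fz /=; last by lia.
  by rewrite mulmxA -fy //; apply: IHm => /=; lia.
pose c := chord_of i j; have dimE v : rdim (chord_module k c) v = (i <= v <= j)%N by [].
exists c; split; first by rewrite /= /bump /=; lia.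
pose f0 : cochain0 (chord_module k c) M := [ffun v => \matrix_(r, s) y v 0 s].
pose g0 : cochain0 M (chord_module k c) := [ffun v => \matrix_(r, s) z v r 0].
have f_hom : f0 \in @is_hom _ _ _ (chord_module k c) M.
  rewrite inE; apply/eqP/ffunP=> a; rewrite dffun0E !ffunE; apply/matrixP=> r s.
  have /andP[ia aj] : (i <= src a <= j)%N.
    by have := ltn_ord r; rewrite [X in (_ < X)%N]dimE; case: (_ && _).
  rewrite !mxE; set lhs := \sum_j0 _; have -> : lhs = y (tgt a) 0 s.
    by rewrite fy // mxE; apply: eq_bigr => t _; rewrite mxE.
  under eq_bigr => t _ do rewrite !mxE mul1r.
  rewrite sumr_const card_ord dimE.
  have [aj'|ja] := leqP (tgt a) j; first by rewrite (leq_trans ia) ?mulr1n ?subrr //=.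
  suff -> : y (tgt a) = 0 by rewrite mxE mul0rn subrr.
  apply/eqP; apply: contraTT ja => nz; rewrite -leqNgt; apply: maxP.
  by apply/asboolP; exists y.
have g_hom : g0 \in @is_hom _ _ _ M (chord_module k c).
  rewrite inE; apply/eqP/ffunP=> a; rewrite dffun0E !ffunE; apply/matrixP=> r s.
  have /andP[ia aj] : (i <= tgt a <= j)%N.
    by have := ltn_ord s; rewrite [X in (_ < X)%N]dimE; case: (_ && _).
  have ia' : (i <= src a)%N.
    by apply: minM; rewrite -lt0n (leq_trans _ (ltn_ord r)).
  rewrite !mxE; set rhs := (X in _ - X); have -> : rhs = z (src a) r 0.
    by rewrite fz // mxE; apply: eq_bigr => t _; rewrite mxE.
  under eq_bigr => t _ do rewrite !mxE mulr1.
  rewrite sumr_const card_ord dimE ia'.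
  by rewrite (ltnW aj) mulr1n subrr.
pose f : hom (chord_module k c) M :=
  exist (fun h => h \in @is_hom _ _ _ (chord_module k c) M) f0 f_hom.
pose g : hom M (chord_module k c) :=
  exist (fun h => h \in @is_hom _ _ _ M (chord_module k c)) g0 g_hom.
have fg : hom_comp f g = hom_id (chord_module k c).
  apply/val_inj/ffunP=> v; rewrite !ffunE; apply/matrixP=> r s.
  have ivj : (i <= v <= j)%N.
    by have := ltn_ord r; rewrite [X in (_ < X)%N]dimE; case: (_ && _).
  have -> : r = s.
    apply/val_inj; move: (ltn_ord r) (ltn_ord s).
    rewrite [X in (_ < X)%N -> _]dimE [X in _ -> (_ < X)%N -> _]dimE.
    by rewrite ivj /=; case: (nat_of_ord r) => [|?]; case: (nat_of_ord s) => [|?].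
  rewrite !mxE eqxx; have /matrixP/(_ 0 0) := yz v ivj; rewrite !mxE => <-.
  by apply: eq_bigr => t _; rewrite !mxE.
exists g, f; split=> //; apply: indecomposable_retract fg => // /(_ i).
by rewrite dimE leqnn le_ij.
Qed.

Lemma interval_iso_inj (c d : 'I_n.+1 * 'I_n.+1) : (c.1 < c.2)%N -> (d.1 < d.2)%N ->
  rep_iso (chord_module k c) (chord_module k d) -> c = d.
Proof.
move=> lt_c lt_d iso.
have in_eq (v : nat) : (v < n)%N -> inside c v = inside d v.
  move=> lt_v; have := rep_iso_dim (Ordinal lt_v) iso; rewrite /= /inside.
  by case: (_ <= _ < _)%N; case: (_ <= _ < _)%N.
have ltc2 := ltn_ord c.2; have ltd2 := ltn_ord d.2.
have e1 := in_eq c.1; have e2 := in_eq d.1; have e3 := in_eq c.2.-1; have e4 := in_eq d.2.-1.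
have e5 := in_eq c.2; have e6 := in_eq d.2.
rewrite /inside in e1 e2 e3 e4 e5 e6.
by apply: injective_projections; apply/val_inj => /=; lia.
Qed.
End Classification.

(** * Covering relations and paths *)

Section Covers.
Variables (I : finType) (R : rel I).

Definition cover (i j : I) : Prop :=
  [/\ R i j, i != j & forall l, R i l -> R l j -> l = i \/ l = j].

Definition hasse_quiver (G : quiver I) : Prop :=
  [/\ forall a : arr G, cover (src a) (tgt a),
      forall a b : arr G, src a = src b -> tgt a = tgt b -> a = b &
      forall i j, cover i j -> exists a : arr G, src a = i /\ tgt a = j].

Definition path_end (G : quiver I) (v : I) (s : seq (arr G)) := last v [seq tgt a | a <- s].
(** The paths that will turn out to be nonzero in the Ext algebra: the product of
    the generators along the path stays nonzero as long as the relation holds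
    between the source and the vertex reached. *)
Definition good (G : quiver I) (v : I) (s : seq (arr G)) := all (fun a => R v (tgt a)) s.

(** The ideal of relations is spanned by paths, so membership is a condition on
    the coefficients, in which the lifts of the arrows do not occur. *)
Definition presented (k : fieldType) (G : bound_quiver k I) : Prop :=
  hasse_quiver G /\ forall x : {malg k[qpath G]},
    bq_rel x <-> forall p : qpath G, good (val p).1 (val p).2 -> x@_p = 0.

Lemma path_end_rcons (G : quiver I) v (s : seq (arr G)) a : path_end v (rcons s a) = tgt a.
Proof. by rewrite /path_end map_rcons last_rcons. Qed.

Lemma is_path_rcons (G : quiver I) v (s : seq (arr G)) a :
  is_path v (rcons s a) = is_path v s && (src a == path_end v s).
Proof. by elim: s v => [|b s IHs] v /=; rewrite ?andbT // IHs andbA. Qed.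

Lemma good_rcons (G : quiver I) v (s : seq (arr G)) a :
  good v (rcons s a) = good v s && R v (tgt a).
Proof. by rewrite /good all_rcons andbC. Qed.

End Covers.

Section LocalOrder.
Variables (I : finType) (R : rel I).

(** What remains of a partial order when chords are related only at a common
    vertex: [local_comp] is the part of transitivity that survives, and the
    elements between two given ones form a chain. *)
Record local_order : Prop := LocalOrder {
  local_refl : forall i, R i i;
  local_rank : exists rk : I -> nat, forall i j, R i j -> i != j -> (rk i < rk j)%N;
  local_comp : forall i m l j, R i m -> R m l -> R l j -> R m j -> R i j -> R i l;
  local_chain : forall i j l m, R i j -> R i l -> R l j -> R i m -> R m j -> R l m || R m l }.

Hypothesis loR : local_order.

Lemma local_anti i j : R i j -> R j i -> i = j.
Proof.
have [rk rkP] := local_rank loR => ij ji; apply/eqP; apply: contraT => nij.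
have := rkP _ _ ij nij; rewrite ltnNge ltnW // rkP //; by rewrite eq_sym.
Qed.

Variable G : quiver I.
Hypothesis hG : hasse_quiver R G.

Lemma good_end v (s : seq (arr G)) : good R v s -> R v (path_end v s).
Proof.
elim/last_ind: s => [|s a _]; first by rewrite /path_end /= local_refl.
by rewrite good_rcons path_end_rcons => /andP[].
Qed.

(** The last arrows of two good paths with the same ends start at comparable
    vertices, and covering forces these to be equal; then go backwards along the
    paths. *)
Lemma good_unique v (s t : seq (arr G)) : is_path v s -> is_path v t ->
  good R v s -> good R v t -> path_end v s = path_end v t -> s = t.
Proof.
have [coverG uniqG _] := hG.
have nil (a : arr G) u : is_path v (rcons u a) -> good R v (rcons u a) -> tgt a != v.
  rewrite is_path_rcons good_rcons => /andP[_ /eqP sa] /andP[gu va].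
  have [ca nca _] := coverG a; apply: contraNneq nca => av; apply/eqP.
  by apply: local_anti => //; rewrite av sa good_end.
elim/last_ind: s t => [|s a IHs] t; case/lastP: t => [|t b] // ps pt gs gt.
- by rewrite path_end_rcons /path_end /= => ev; have := nil b t pt gt; rewrite -ev eqxx.
- by rewrite path_end_rcons /path_end /= => ev; have := nil a s ps gs; rewrite ev eqxx.
rewrite !path_end_rcons => eab.
move: ps pt gs gt; rewrite !is_path_rcons !good_rcons.
move=> /andP[ps /eqP sa] /andP[pt /eqP sb] /andP[gs va] /andP[gt vb].
have [ca nca cov_a] := coverG a; have [cb ncb cov_b] := coverG b.
have esrc : src a = src b.
  have /orP[ab|ba] : R (src a) (src b) || R (src b) (src a).
    by apply: (local_chain loR va) => //; rewrite ?sa ?sb ?good_end // -?sa -?sb ?eab.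
  - have /(cov_a _ ab)[//|e] : R (src b) (tgt a) by rewrite eab.
    by rewrite e eab eqxx in ncb.
  - have /(cov_b _ ba)[//|e] : R (src a) (tgt b) by rewrite -eab.
    by rewrite e -eab eqxx in nca.
have -> : a = b by apply: uniqG.
by congr rcons; apply: IHs => //; rewrite -sa -sb esrc.
Qed.

(** Among the vertices between [i] and [j] other than [j], one of maximal rank is
    covered by [j]. *)
Lemma good_exists i j : R i j ->
  exists s : seq (arr G), [/\ is_path i s, good R i s & path_end i s = j].
Proof.
have [_ _ exG] := hG; have [rk rkP] := local_rank loR.
have [m] := ubnP (rk j); elim: m j => // m IHm j lt_m ij.
have [<-|nij] := eqVneq i j; first by exists [::].
(* The candidates for the last vertex before [j] on the path. *)
pose P l := [&& R i l, R l j & l != j].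
have Pi : P i by rewrite /P ij nij local_refl.
case: (@arg_maxnP _ i P rk Pi) => l /and3P[il lj nlj] maxl.
have cov : cover R l j.
  split=> // l' ll' l'j; have [->|nl'j] := eqVneq l' j; first by right.
  left; apply/eqP; apply: contraT => nl'l.
  have il' : R i l' by apply: (local_comp loR il ll' l'j).
  have /maxl : P l' by rewrite /P il' l'j.
  by rewrite /= leqNgt rkP // eq_sym.
have [a [sa ta]] := exG _ _ cov.
have [|s [ps gs es]] := IHm l _ il.
  by rewrite -ltnS (leq_trans _ lt_m) // ltnS rkP.
exists (rcons s a); rewrite is_path_rcons good_rcons path_end_rcons ps gs ta ij es sa eqxx.
by [].
Qed.
End LocalOrder.

(** * The Ext algebra as an incidence algebra *)

Section BasedAlgebra.
Variables (k : fieldType) (W : finType) (Q : quiver W) (I : finType).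
Variables (E : I -> rep k Q) (R : rel I).

(** A choice of generators of the spaces Hom + Ext^1 for which the structure
    constants of the Ext algebra are all equal to 1. *)
Record ext_basis (beta : forall i j, gext (E i) (E j)) : Prop := ExtBasis {
  basis_span : forall i j (x : gext (E i) (E j)), exists z, x = z *: beta i j;
  basis_neq0 : forall i j, (beta i j != 0) = R i j;
  basis_id : forall i, beta i i = gid (E i);
  basis_comp : forall i j l, R i j -> R j l -> R i l ->
    gcomp (beta i j) (beta j l) = beta i l }.

Variable beta : forall i j, gext (E i) (E j).
Hypothesis eb : ext_basis beta.
Hypothesis R_refl : reflexive R.
Hypothesis R_rank : exists rk : I -> nat, forall i j, R i j -> i != j -> (rk i < rk j)%N.

Local Notation A := (extalg E).

Lemma beta_eq0 i j : ~~ R i j -> beta i j = 0.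
Proof. by rewrite -(basis_neq0 eb) negbK => /eqP. Qed.

Lemma gext_rel i j (x : gext (E i) (E j)) : x != 0 -> R i j.
Proof.
have [z ->] := basis_span eb x; rewrite -(basis_neq0 eb); apply: contraNneq => ->.
by rewrite scaler0.
Qed.

Lemma beta_mul i j l : R i j -> R j l -> gcomp (beta i j) (beta j l) = beta i l.
Proof.
move=> ij jl; have [il|nil] := boolP (R i l); first exact: basis_comp.
have [z ->] := basis_span eb (gcomp (beta i j) (beta j l)).
by rewrite (beta_eq0 nil) scaler0.
Qed.

(** Associativity: the product of the generators from [i] to [m], [m] to [l] and
    [l] to [j] is nonzero, so its first two factors have a nonzero product. *)
Lemma ext_basis_comp i m l j : R i m -> R m l -> R l j -> R m j -> R i j -> R i l.
Proof.
move=> im ml lj mj ij; apply: contraT => /beta_eq0 b0.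
have := basis_neq0 eb i j; rewrite ij -(beta_mul im mj) -(beta_mul ml lj) gcompA.
by rewrite (beta_mul im ml) b0 gcomp0l eqxx.
Qed.

Definition unit_elt i j : A := [ffun p => if p == (i, j) then beta p.1 p.2 else 0].

Lemma component_unit i j l m :
  component (unit_elt i j) l m = if (l, m) == (i, j) then beta l m else 0.
Proof. by rewrite /component ffunE. Qed.

Lemma idem_unit i : idem E i = unit_elt i i.
Proof.
apply: extalgP => l m; rewrite component_unit /component ffunE.
by case: eqP => // -[-> ->] /=; rewrite gunitE (basis_id eb).
Qed.

Lemma unit_mul i j l : R i j -> R j l -> unit_elt i j * unit_elt j l = unit_elt i l.
Proof.
move=> ij jl; apply: extalgP => u v; rewrite component_mulr component_unit.
rewrite (bigD1 j) //= big1 => [|w nwj]; rewrite !component_unit !xpair_eqE.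
  rewrite !eqxx andbT /= addr0; case: eqP => [->|_] /=; last by rewrite gcomp0l.
  case: eqP => [->|_] /=; [exact: beta_mul | exact: gcomp0r].
by rewrite (negPf nwj) andbF gcomp0l.
Qed.

Lemma block_unit i j (x : A) : in_block i j x -> exists z, x = z *: unit_elt i j.
Proof.
move=> bx; have [z xij] := basis_span eb (component x i j); exists z.
apply: extalgP => l m; rewrite componentZ component_unit.
case: eqP => [[-> ->]//|/eqP n]; by rewrite scaler0 bx.
Qed.

Definition zero_diag (x : A) := forall i, component x i i = 0.

Lemma mul_rel (x y : A) i j : component (x * y) i j != 0 ->
  exists l, component x i l != 0 /\ component y l j != 0.
Proof.
move=> nz; apply: contrapT => no_l; case/eqP: nz.
rewrite component_mulr big1 // => l _.
have [->|nx] := eqVneq (component x i l) 0; first by rewrite gcomp0l.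
have [->|ny] := eqVneq (component y l j) 0; first by rewrite gcomp0r.
by case: no_l; exists l.
Qed.

Lemma R_anti i j : R i j -> R j i -> i = j.
Proof.
have [rk rkP] := R_rank => ij ji; apply/eqP; apply: contraT => nij.
have := rkP _ _ ij nij; rewrite ltnNge ltnW // rkP //; by rewrite eq_sym.
Qed.

Lemma mul_zero_diag (a x : A) i : component x i i = 0 -> component (a * x) i i = 0.
Proof.
move=> x0; apply/eqP; apply: contraT => /mul_rel[l [/gext_rel il xl]].
have li := gext_rel xl; move: xl; rewrite -(R_anti il li) x0 eqxx //.
Qed.

(** It has codimension one; it is a left ideal because the relation has no
    cycle, so that only the factor at [i] contributes at [(i, i)]. *)
Lemma zero_diag_maximal i : maximal_left_ideal (fun x : A => component x i i = 0).
Proof.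
split.
- split=> [|x y x0 y0|a x x0]; first exact: component0.
    by rewrite componentD x0 y0 addr0.
  exact: mul_zero_diag.
- rewrite component_one gunitE -(basis_id eb); apply/eqP.
  by rewrite (basis_neq0 eb) R_refl.
move=> K [_ KD KM] subK.
have [[x [Kx nx]]|no_x] := EM (exists x, K x /\ component x i i != 0); last first.
  right=> x Kx; apply/eqP; apply: contraT => nx; case: no_x; by exists x.
left; have [z xz] := basis_span eb (component x i i).
have z0 : z != 0 by apply: contraNneq nx => z0; rewrite xz z0 scale0r.
pose u : A := z^-1 *: (1 : A).
have := KD _ _ (KM u _ Kx) (subK (1 - u * x) _).
rewrite [u * x + _]addrC subrK; apply.
rewrite /u -extalg_scaleAl mul1r componentD component_one gunitE.
rewrite -scaleNr componentZ xz scalerA mulNr mulVf // scaleN1r (basis_id eb) subrr //.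
Qed.

Lemma zero_diag_nilpotent (x : A) : zero_diag x -> exists m, x ^+ m = 0.
Proof.
move=> x0; have [rk rkP] := R_rank.
have pow m i j : component (x ^+ m) i j != 0 -> (rk i + m <= rk j)%N.
  elim: m i => [|m IHm] i.
    rewrite addn0 expr0 => /gext_rel ij; have [->//|nij] := eqVneq i j.
    by apply/ltnW/rkP.
  rewrite exprS => /mul_rel[l [xil /IHm lj]].
  have nil : i != l by apply: contraNneq xil => <-; rewrite x0.
  by have := rkP _ _ (gext_rel xil) nil; lia.
exists (\max_i rk i).+1; apply: extalgP => i j; rewrite component0.
apply/eqP; apply: contraT => /pow; have := leq_bigmax (F := rk) j; lia.
Qed.

(** If [x] has zero diagonal but is not in the maximal left ideal [J], then [J]
    contains some [1 - a x] with [a x] nilpotent, hence contains 1. *)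
Lemma jacobsonE (x : A) : jacobson x <-> zero_diag x.
Proof.
split=> [Jx i|x0 J maxJ]; first exact: (Jx _ (zero_diag_maximal i)).
have [[J0 JD JM] J1 maxJ'] := maxJ.
(* The left ideal generated by [J] and [x]. *)
pose K y := exists j a, J j /\ y = j + a * x.
have lK : left_ideal K.
  split=> [|y z [j [a [Jj ->]]] [j' [a' [Jj' ->]]]|b y [j [a [Jj ->]]]].
  - by exists 0, 0; rewrite mul0r addr0.
  - by exists (j + j'), (a + a'); split; [exact: JD | rewrite mulrDl addrACA].
  by exists (b * j), (b * a); split; [exact: JM | rewrite mulrDr mulrA].
have [|K1|KJ] := maxJ' K lK.
- by move=> j Jj; exists j, 0; rewrite mul0r addr0.
- have [j [a [Jj e1]]] := K1; set y := a * x in e1.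
  have jE : j = 1 - y by rewrite e1 addrK.
  have y0 : zero_diag y by move=> i; apply: mul_zero_diag; apply: x0.
  have [m ym] := zero_diag_nilpotent y0.
  suff down d : (d <= m)%N -> J (y ^+ (m - d)).
    by case: J1; have := down m (leqnn m); rewrite subnn expr0.
  elim: d => [|d IHd] lt_d; first by rewrite subn0 ym.
  have -> : y ^+ (m - d.+1) = y ^+ (m - d.+1) * j + y ^+ (m - d).
    by rewrite jE mulrBr mulr1 -exprSr -subSn // subSS subrK.
  by apply: JD; [apply: JM | apply: IHd; apply: ltnW].
by apply: KJ; exists 0, 1; rewrite mul1r add0r.
Qed.

Lemma jacobson_sqE_sub (x : A) i j : jacobson_sq x -> component x i j != 0 ->
  exists l, [/\ l != i, l != j, R i l & R l j].
Proof.
move=> [s [Js ->]]; elim: s Js => [|[y z] s IHs] Js.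
  by rewrite big_nil component0 eqxx.
rewrite big_cons componentD.
have [yz0|/mul_rel[l [yil zlj]] _] := eqVneq (component (y * z) i j) 0.
  by rewrite yz0 add0r; apply: IHs => w sw; apply: Js; rewrite inE sw orbT.
have [/jacobsonE y0 /jacobsonE z0] := Js (y, z) (mem_head _ _).
exists l; split; [..|exact: gext_rel yil|exact: gext_rel zlj].
  by apply: contraNneq yil => ->; rewrite y0.
by apply: contraNneq zlj => ->; rewrite z0.
Qed.

Lemma unit_jacobson i j : i != j -> jacobson (unit_elt i j).
Proof.
move=> nij; apply/jacobsonE => l; rewrite component_unit xpair_eqE.
by case: eqP => // ->; rewrite (negPf nij).
Qed.

Lemma unit_in_block i j : in_block i j (unit_elt i j).
Proof. by move=> l m n; rewrite component_unit (negPf n). Qed.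

Lemma unit_jacobson_sq z i l j : l != i -> l != j -> R i l -> R l j ->
  jacobson_sq (z *: unit_elt i j).
Proof.
move=> nli nlj il lj; exists [:: (z *: unit_elt i l, unit_elt l j)]; split.
  move=> w; rewrite inE => /eqP -> /=; split; last exact: unit_jacobson.
  by apply: jacobsonZ; apply: unit_jacobson; rewrite eq_sym.
by rewrite big_seq1 /= -extalg_scaleAl unit_mul.
Qed.

Lemma jacobson_sq0 : jacobson_sq (0 : A).
Proof. by exists [::]; rewrite big_nil. Qed.

Lemma sum_delta (G : quiver I) (ell : arr G -> A) (c : arr G -> k) (P : pred (arr G)) a :
  P a -> (forall b, P b -> b != a -> c b = 0) -> \sum_(b | P b) c b *: ell b = c a *: ell a.
Proof.
move=> Pa c0; rewrite (bigD1 a) //= big1 ?addr0 // => b /andP[Pb nba].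
by rewrite c0 // scale0r.
Qed.

(** Each component of the radical is spanned by one generator, which lies in the
    square of the radical exactly when the pair is not a covering pair. So there
    is one arrow for each covering pair, and its lift is determined up to a
    nonzero scalar. *)
Lemma arrow_lift_hasse (G : quiver I) (ell : arr G -> A) : arrow_lift ell ->
  hasse_quiver R G /\
  forall a, exists2 z, z != 0 & ell a = z *: unit_elt (src a) (tgt a).
Proof.
move=> [lift1 lift2].
have indep a (c : arr G -> k) :
    jacobson_sq (\sum_(b | (src b == src a) && (tgt b == tgt a)) c b *: ell b) -> c a = 0.
  by have [H _] := lift2 (src a) (tgt a) => /H; apply.
have nsq a : ~ jacobson_sq (ell a).
  move=> sq; have := indep a (fun b => (b == a)%:R); rewrite (@sum_delta _ _ _ _ a) ?eqxx //.
    by rewrite scale1r => /(_ sq) /eqP; rewrite oner_eq0.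
  by move=> b _ /negPf ->.
have ellE a : exists2 z, z != 0 & ell a = z *: unit_elt (src a) (tgt a).
  have [_ /block_unit[z ez]] := lift1 a; exists z => //.
  by apply: contra_notN (nsq a) => /eqP z0; rewrite ez z0 scale0r; apply: jacobson_sq0.
split=> //; split.
- move=> a; have [z nz ez] := ellE a; have [/jacobsonE Ja _] := lift1 a.
  have Ra : R (src a) (tgt a).
    apply: contraT => /beta_eq0 b0; case: (nsq a); rewrite ez.
    suff -> : unit_elt (src a) (tgt a) = 0 by rewrite scaler0; apply: jacobson_sq0.
    apply: extalgP => l m; rewrite component_unit component0.
    by case: eqP => // -[-> ->].
  have na : src a != tgt a.
    apply/eqP=> e; have /eqP := Ja (src a); rewrite ez componentZ component_unit -e eqxx.
    by rewrite scaler_eq0 (negPf nz) -[_ == 0]negbK (basis_neq0 eb) R_refl.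
  split=> // l il lj; apply: contrapT => /not_orP[/eqP nli /eqP nlj].
  by apply: (nsq a); rewrite ez; apply: (@unit_jacobson_sq z (src a) l (tgt a)).
- move=> a b esrc etgt; apply/eqP; apply: contraT => nab.
  have [z nz ez] := ellE a; have [w nw ew] := ellE b.
  (* The lifts of two parallel arrows would be proportional. *)
  pose c d : k := if d == a then w else if d == b then - z else 0.
  have := indep a c; rewrite (bigD1 a) ?eqxx //=.
  rewrite (@sum_delta _ _ _ _ b) ?esrc ?etgt ?eqxx // 1?eq_sym //; last first.
    by move=> d /andP[_ /negPf nda] /negPf ndb; rewrite /c nda ndb.
  rewrite /c eqxx [b == a]eq_sym (negPf nab) eqxx ez ew esrc etgt.
  rewrite !scalerA mulrC mulNr -scalerDl subrr scale0r.
  by move=> /(_ jacobson_sq0) w0; rewrite w0 eqxx in nw.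
move=> i j [ij nij cov]; have [_ spn] := lift2 i j.
have [c sq] := spn _ (unit_jacobson nij) (@unit_in_block i j).
have [/existsP[a /andP[/eqP si /eqP tj]]|/existsPn no_a] :=
  boolP [exists a : arr G, (src a == i) && (tgt a == j)]; first by exists a.
move: sq; rewrite big_pred0 ?subr0 => [|a]; last exact: negPf (no_a a).
move=> /(jacobson_sqE_sub (i := i) (j := j)); rewrite component_unit eqxx (basis_neq0 eb) ij.
by move=> /(_ isT)[l [nli nlj il lj]]; have [e|e] := cov l il lj; rewrite e eqxx in nli nlj.
Qed.

Section Evaluation.
Hypothesis R_chain : forall i j l m, R i j -> R i l -> R l j -> R i m -> R m j -> R l m || R m l.

Lemma ext_basis_local_order : local_order R.
Proof. by split=> //; exact: ext_basis_comp. Qed.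

Variables (G : quiver I) (ell : arr G -> A).
Hypothesis hG : hasse_quiver R G.
Hypothesis ellE : forall a, exists2 z, z != 0 & ell a = z *: unit_elt (src a) (tgt a).

Lemma path_valueE v (s : seq (arr G)) : is_path v s -> exists2 z, z != 0 &
  idem E v * \prod_(a <- s) ell a = z *: (if good R v s then unit_elt v (path_end v s) else 0).
Proof.
elim/last_ind: s => [|s a IHs].
  by exists 1; rewrite ?oner_eq0 // big_nil mulr1 scale1r idem_unit.
rewrite is_path_rcons good_rcons path_end_rcons => /andP[/IHs[z nz ez] /eqP sa].
have [w nw ew] := ellE a; have [Ra _ _] := let: And3 h _ _ := hG in h a.
exists (z * w); first by rewrite mulf_neq0.
rewrite -cats1 big_cat big_seq1 /= mulrA ez ew -sa -extalg_scaleAl -extalg_scaleAr scalerA.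
case: ifP => gs /=; last by rewrite mul0r.
have Rv : R v (src a) by rewrite sa; apply: (good_end ext_basis_local_order).
rewrite unit_mul //; congr (_ *: _); case: ifP => // /negbT/beta_eq0 b0.
apply: extalgP => l m; rewrite component_unit component0.
by case: eqP => // -[-> ->].
Qed.

(** Good paths with different ends have values in different components, and
    those with the same ends are equal, so the values of the good paths are
    linearly independent. *)
Lemma pathalg_eval0 (x : {malg k[qpath G]}) : pathalg_eval ell x = 0 <->
  forall p : qpath G, good R (val p).1 (val p).2 -> x@_p = 0.
Proof.
split=> [x0 p gp|x0]; last first.
  rewrite /pathalg_eval big1_seq // => p /andP[_ px].
  have [z _] := path_valueE (valP p); rewrite /path_value => ->.
  case: ifP => gp; last by rewrite !scaler0.
  by rewrite x0 ?scale0r.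
have [px|/mcoeff_outdom//] := boolP (p \in msupp x).
have := congr1 (fun y : A => component y (val p).1 (path_end (val p).1 (val p).2)) x0.
rewrite /pathalg_eval component0.
rewrite (big_morph (fun y : A => component y _ _)
  (fun y y' => componentD y y' _ _) (component0 E _ _)).
rewrite (big_fsetD1 p) //= big_seq_cond big1 => [|q].
  rewrite addr0 componentZ; have [z nz] := path_valueE (valP p).
  rewrite -/(path_value ell p) => ->; rewrite gp componentZ component_unit eqxx scalerA => /eqP.
  rewrite scaler_eq0 mulf_eq0 (negPf nz) orbF => /orP[/eqP//|].
  by rewrite -[_ == 0]negbK (basis_neq0 eb) (good_end ext_basis_local_order).
rewrite andbT in_fsetD1 => /andP[nqp _].
rewrite componentZ; have [z nz] := path_valueE (valP q).
rewrite -/(path_value ell q) => ->; case: ifP => gq; last by rewrite scaler0 component0 scaler0.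
rewrite componentZ component_unit; case: eqP => [[e1 e2]|_]; last by rewrite !scaler0.
case/eqP: nqp; apply/val_inj.
have := valP q; have := valP p; move: gp e1 gq e2 => /=.
case: (sval p) (sval q) => [v s] [w t] /= gs <- gt e2 ps pt.
by congr pair; apply: (good_unique ext_basis_local_order hG pt ps gt gs).
Qed.
End Evaluation.

Lemma hom_ext_quiver_presented (G : bound_quiver k I) :
  (forall i j l m, R i j -> R i l -> R l j -> R i m -> R m j -> R l m || R m l) ->
  hom_ext_quiver E G -> presented R G.
Proof.
move=> R_chain [ell [/arrow_lift_hasse[hG ellE] relE]]; split=> // x.
by rewrite relE pathalg_eval0.
Qed.

End BasedAlgebra.

(** * Isomorphisms of quivers with relations *)

Section QuiverIso.
Variables (k : fieldType) (I I' : finType) (G : quiver I) (G' : quiver I').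

Lemma iso_path_inj (f : quiver_iso G G') : injective (iso_path f).
Proof.
have [/bij_inj vinj /bij_inj ainj] := (iso_vert_bij f, iso_arr_bij f).
move=> p q /(congr1 val) /= [/vinj e1 /(inj_map ainj) e2].
by apply/val_inj; rewrite /= [LHS]surjective_pairing [RHS]surjective_pairing e1 e2.
Qed.

Lemma quiver_iso_inverse (f : quiver_iso G G') :
  exists f' : quiver_iso G' G, cancel (iso_path f') (iso_path f).
Proof.
have [g fg gf] := iso_vert_bij f; have [h fh hf] := iso_arr_bij f.
have hsrc a : src (h a) = g (src a) by rewrite -{2}[a]hf iso_src fg.
have htgt a : tgt (h a) = g (tgt a) by rewrite -{2}[a]hf iso_tgt fg.
exists (QuiverIso (Bijective gf fg) (Bijective hf fh) hsrc htgt) => p.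
apply/val_inj; rewrite /= gf mapK //; by case: (sval p).
Qed.

Lemma iso_path_surj (f : quiver_iso G G') q : exists p, iso_path f p = q.
Proof. by have [f' f'K] := quiver_iso_inverse f; exists (iso_path f' q). Qed.

Lemma iso_pathalg_coef (f : quiver_iso G G') (x : {malg k[qpath G]}) p :
  (iso_pathalg f x)@_(iso_path f p) = x@_p.
Proof.
rewrite /iso_pathalg raddf_sum /=.
under eq_bigr => q _ do rewrite mcoeffU (inj_eq (@iso_path_inj f)).
have [px|px] := boolP (p \in msupp x).
  rewrite (big_fsetD1 p) //= eqxx mulr1n big_seq_cond big1 ?addr0 // => q.
  by rewrite andbT in_fsetD1 => /andP[/negPf -> _].
rewrite (mcoeff_outdom px) big_seq_cond big1 // => q; rewrite andbT => qx.
by have /negPf -> : q != p by apply: contraNneq px => <-.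
Qed.

Lemma iso_path_end (f : quiver_iso G G') v s :
  path_end (iso_vert f v) (map (iso_arr f) s) = iso_vert f (path_end v s).
Proof.
by rewrite /path_end; elim: s v => [|a s IHs] v //=; rewrite iso_tgt; apply: IHs.
Qed.
End QuiverIso.

Section Presented.
Variables (k : fieldType) (I : finType) (R R' : rel I) (G G' : bound_quiver k I).
Hypotheses (loR : local_order R) (loR' : local_order R').
Hypotheses (prG : presented R G) (prG' : presented R' G').

(** A path is good exactly when, as an element of the path algebra, it is not a
    relation, so an isomorphism preserves good paths; and two vertices are
    related exactly when a good path joins them. *)
Lemma bound_iso_rel : bound_quiver_iso G G' ->
  exists2 phi : I -> I, injective phi & forall i j, R i j = R' (phi i) (phi j).
Proof.
move=> [f fP]; have [hG relG] := prG; have [hG' relG'] := prG'.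
have bad (p : qpath G) : good R (val p).1 (val p).2 =
    good R' (val (iso_path f p)).1 (val (iso_path f p)).2.
  apply/idP/idP=> gp; apply: contraT => ngp.
    have : bq_rel (<< iso_path f p >> : {malg k[qpath G']}).
      apply/relG' => q gq; rewrite mcoeffU; case: eqP => // e.
      by rewrite e gq in ngp.
    move=> /fP[x /relG/(_ p gp) xp0 /(congr1 (mcoeff (iso_path f p)))].
    by rewrite mcoeffUU iso_pathalg_coef xp0 => /eqP; rewrite oner_eq0.
  have /fP/relG'/(_ _ gp) : exists2 x : {malg k[qpath G]}, bq_rel x &
      iso_pathalg f << p >> = iso_pathalg f x.
    exists << p >> => //; apply/relG => q gq; rewrite mcoeffU; case: eqP => // e.
    by rewrite e gq in ngp.
  by rewrite iso_pathalg_coef mcoeffUU => /eqP; rewrite oner_eq0.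
have vinj := bij_inj (iso_vert_bij f).
exists (iso_vert f) => // i j; apply/idP/idP=> ij.
  have [s [ps gs <-]] := good_exists loR hG ij.
  have := bad (exist (fun p => is_path p.1 p.2) (i, s) ps); rewrite /= gs => /esym gs'.
  by rewrite -iso_path_end; apply: (good_end loR' gs').
have [s [ps gs es]] := good_exists loR' hG' ij.
have [p ep] := iso_path_surj f (exist (fun p => is_path p.1 p.2) (iso_vert f i, s) ps).
have := bad p; rewrite ep /= gs => gp.
have [e1 e2] : iso_vert f (val p).1 = iso_vert f i /\ map (iso_arr f) (val p).2 = s.
  by have [-> ->] := congr1 val ep.
have := good_end loR gp; rewrite (vinj _ _ e1).
by rewrite (_ : path_end _ _ = j) //; apply: vinj; rewrite -iso_path_end e2.
Qed.

(** Arrows are covering pairs, so [phi] acts on arrows; it preserves good paths,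
    hence the span of the other paths. *)
Lemma rel_bound_iso (phi : I -> I) : injective phi ->
  (forall i j, R i j = R' (phi i) (phi j)) -> bound_quiver_iso G G'.
Proof.
move=> phi_inj phiR; have [[cG uG eG] relG] := prG; have [[cG' uG' eG'] relG'] := prG'.
have [psi phiK psiK] := injF_bij phi_inj.
have coverE i j : cover R i j -> cover R' (phi i) (phi j).
  move=> [ij nij cov]; split; rewrite -?phiR ?(inj_eq phi_inj) // => l.
  rewrite -[l]psiK -!phiR => il lj.
  by have [->|->] := cov _ il lj; [left|right].
have coverE' i j : cover R' i j -> cover R (psi i) (psi j).
  move=> [ij nij cov]; split; rewrite ?phiR ?psiK ?(can_eq psiK) // => l.
  by rewrite !phiR !psiK => il lj; have [<-|<-] := cov _ il lj; rewrite phiK; [left|right].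
have /choice[g gP] (a : arr G) : exists b : arr G', src b = phi (src a) /\ tgt b = phi (tgt a).
  exact/eG'/coverE/cG.
have /choice[h hP] (b : arr G') : exists a : arr G, src a = psi (src b) /\ tgt a = psi (tgt b).
  exact/eG/coverE'/cG'.
have gh : cancel g h.
  move=> a; have [[s1 t1] [s2 t2]] := (gP a, hP (g a)).
  by apply: uG; rewrite ?s2 ?t2 ?s1 ?t1 phiK.
have hg : cancel h g.
  move=> b; have [[s1 t1] [s2 t2]] := (hP b, gP (h b)).
  by apply: uG'; rewrite ?s2 ?t2 ?s1 ?t1 psiK.
pose f := QuiverIso (Bijective phiK psiK) (Bijective gh hg)
  (fun a => proj1 (gP a)) (fun a => proj2 (gP a)).
have goodE (p : qpath G) : good R (val p).1 (val p).2 =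
    good R' (val (iso_path f p)).1 (val (iso_path f p)).2.
  rewrite /good /= all_map; apply: eq_all => a /=.
  by rewrite (proj2 (gP a)) phiR.
exists f => y; rewrite relG'.
have [f' f'K] := quiver_iso_inverse f.
have f'K' : cancel (iso_path f) (iso_path f').
  by move=> p; apply: (@iso_path_inj _ _ _ _ f); rewrite f'K.
split=> [y0|[x /relG x0 ->] q gq].
  exists (iso_pathalg f' y).
    apply/relG => p gp; rewrite -[p]f'K' iso_pathalg_coef; apply: y0.
    by rewrite -goodE.
  apply/malgP => q; rewrite -(iso_pathalg_coef f') -(iso_pathalg_coef f).
  by rewrite f'K.
by rewrite -[q]f'K iso_pathalg_coef; apply: x0; rewrite goodE f'K.
Qed.
End Presented.

(** * Complete exceptional collections *)

(** Isomorphisms in the form of invertible elements for the product of Hom and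
    Ext^1. *)
Lemma iso_gext (k : fieldType) (W : finType) (Q : quiver W) (M N : rep k Q) :
  rep_iso M N -> exists uw : gext M N * gext N M,
    gcomp uw.1 uw.2 = gid M /\ gcomp uw.2 uw.1 = gid N.
Proof.
move=> [f [g [fg gf]]]; exists ((f, 0), (g, 0)).
by rewrite /gcomp /gid /= fg gf !ext_pull0 !ext_push0 !addr0.
Qed.

Section Transport.
Variables (k : fieldType) (W : finType) (Q : quiver W) (I : finType).
Variables (E F : I -> rep k Q) (R : rel I).
Variable beta : forall i j, gext (F i) (F j).
Hypothesis eb : ext_basis R beta.
Hypothesis isoEF : forall i, rep_iso (E i) (F i).

Lemma ext_basis_transport : exists beta' : forall i j, gext (E i) (E j), ext_basis R beta'.
Proof.
pose T i := (gext (E i) (F i) * gext (F i) (E i))%type.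
have [uw uwP] : exists uw : forall i, T i, forall i,
    gcomp (uw i).1 (uw i).2 = gid (E i) /\ gcomp (uw i).2 (uw i).1 = gid (F i).
  exists (fun i => projT1 (cid (iso_gext (isoEF i)))) => i.
  exact: projT2 (cid (iso_gext (isoEF i))).
pose u i := (uw i).1; pose w i := (uw i).2.
have uwE i : gcomp (u i) (w i) = gid (E i) by case: (uwP i).
have wuE i : gcomp (w i) (u i) = gid (F i) by case: (uwP i).
pose fwd i j (x : gext (E i) (E j)) : gext (F i) (F j) := gcomp (gcomp (w i) x) (u j).
pose bwd i j (x : gext (F i) (F j)) : gext (E i) (E j) := gcomp (gcomp (u i) x) (w j).
have fwdK i j (x : gext (E i) (E j)) : bwd i j (fwd i j x) = x.
  by rewrite /bwd /fwd !gcompA uwE gcomp1l -gcompA uwE gcomp1r.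
have bwdK i j (x : gext (F i) (F j)) : fwd i j (bwd i j x) = x.
  by rewrite /bwd /fwd !gcompA wuE gcomp1l -gcompA wuE gcomp1r.
exists (fun i j => bwd i j (beta i j)); split.
- move=> i j x; have [z ez] := basis_span eb (fwd i j x); exists z.
  by rewrite -[LHS]fwdK ez /bwd gcompZr gcompZl.
- move=> i j; rewrite -(basis_neq0 eb); congr (~~ _); apply/eqP/eqP=> [b0|->].
    by rewrite -[LHS]bwdK b0 /fwd gcomp0r gcomp0l.
  by rewrite /bwd gcomp0r gcomp0l.
- by move=> i; rewrite /bwd (basis_id eb) gcomp1r uwE.
move=> i j l ij jl il; rewrite -(basis_comp eb ij jl il) /bwd !gcompA.
by rewrite -(gcompA _ (w j) (u j)) wuE gcomp1r.
Qed.
End Transport.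

Section Collections.
Variables (k : fieldType) (n : nat).
Local Notation Q := (linear_quiver n).

Lemma exceptional_sequence_intervals (E : 'I_n -> rep k Q) : exceptional_sequence E ->
  exists c, exceptional_intervals c /\ forall a, rep_iso (E a) (chord_module k (c a)).
Proof.
move=> [excE zeroE].
have /choice[c cP] (a : 'I_n) : exists d : 'I_n.+1 * 'I_n.+1,
    (d.1 < d.2)%N /\ rep_iso (E a) (chord_module k d).
  by have [/indecomposable_interval] := excE a.
exists c; split=> [|a]; last by case: (cP a).
split=> [a|a b lt_ba]; first by case: (cP a).
have [hom0 ext0] := zeroE a b lt_ba.
have [_ /iso_gext[[u w] /= [_ wu]]] := cP a; have [_ /iso_gext[[u' w'] /= [_ wu']]] := cP b.
rewrite -(gext_unit_neq0 k) negbK; apply/eqP; set x := gext_unit k (c a) (c b).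
have y0 : gcomp (gcomp u x) w' = 0 by case: (gcomp _ _) => f e; rewrite (hom0 f) (ext0 e).
rewrite -[x]gcomp1l -wu -[LHS]gcomp1r -wu' gcompA -(gcompA w u x) -(gcompA w) y0.
by rewrite gcomp0r gcomp0l.
Qed.

Variable c : 'I_n -> 'I_n.+1 * 'I_n.+1.
Hypothesis exc : exceptional_intervals c.

Lemma interval_ext_basis :
  ext_basis (fun a b => arrow_rel (c a) (c b)) (fun a b => gext_unit k (c a) (c b)).
Proof.
split=> [a b x|a b|a|a b d ab bd ad].
- exact: gext_unit_span.
- exact: gext_unit_neq0.
- exact/gext_unit_id/interval_lt.
by apply: gext_unit_comp => //; exact: noncrossing.
Qed.

(** Both [l] and [m] pass through the vertex shared by [i] and [j], where the
    chords are linearly ordered. *)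
Lemma arrow_rel_chain i j l m : arrow_rel (c i) (c j) ->
  arrow_rel (c i) (c l) -> arrow_rel (c l) (c j) ->
  arrow_rel (c i) (c m) -> arrow_rel (c m) (c j) ->
  arrow_rel (c l) (c m) || arrow_rel (c m) (c l).
Proof.
move=> ij il lj im mj.
have [eli|nli] := eqVneq l i; first by rewrite eli im.
have [elj|nlj] := eqVneq l j; first by rewrite elj mj orbT.
have [emi|nmi] := eqVneq m i; first by rewrite emi il orbT.
have [emj|nmj] := eqVneq m j; first by rewrite emj lj.
have [elm|nlm] := eqVneq l m; first by rewrite elm arrow_rel_refl.
have nij : i != j.
  apply: contraNneq nli => eij; apply/eqP; rewrite -eij in lj; exact: arrow_rel_anti lj il.
have adj a b : a != b -> arrow_rel (c a) (c b) -> adjacent c a b.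
  by move=> nab ab; rewrite /adjacent nab ab.
have aij := adj _ _ nij ij; have ail : adjacent c i l by apply: adj; rewrite // eq_sym.
have ajl : adjacent c j l by rewrite adjacentC adj.
have aim : adjacent c i m by apply: adj; rewrite // eq_sym.
have ajm : adjacent c j m by rewrite adjacentC adj.
have /(adjacentP exc)[_ [v /andP[iv jv]]] := aij.
have lv := clique_common exc aij ail ajl iv jv.
have mv := clique_common exc aij aim ajm iv jv.
have /andP[_] // : adjacent c l m.
by apply/(adjacentP exc); split=> //; exists v; rewrite lv.
Qed.

Lemma arrow_rel_rank a b : arrow_rel (c a) (c b) -> a != b -> (a < b)%N.
Proof. by move=> /(arrow_rel_le exc) ab nab; rewrite ltn_neqAle nab. Qed.

End Collections.

(** The permutation [s] puts the collection in exceptional order, in which the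
    chords [c] are listed. *)
Lemma collection_presented (k : fieldType) (n : nat) (chi : 'I_n -> rep k (linear_quiver n)) :
  complete_exceptional_collection chi -> exists (s : 'S_n) (c : 'I_n -> 'I_n.+1 * 'I_n.+1),
  let R a b := arrow_rel (c ((s^-1)%g a)) (c ((s^-1)%g b)) in
  [/\ exceptional_intervals c, tree chi = chord_tree c, local_order R &
      forall G, hom_ext_quiver chi G -> presented R G].
Proof.
move=> [s /exceptional_sequence_intervals[c [exc iso]]]; exists s, c => R.
pose t := (s^-1)%g; have tK a : s (t a) = a by rewrite /t permKV.
have eb : ext_basis R (fun a b => gext_unit k (c (t a)) (c (t b))).
  have e := interval_ext_basis k exc.
  split=> [a b x|a b|a|a b d]; [exact: (basis_span e)|exact: (basis_neq0 e)|exact: (basis_id e)|].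
  exact: (basis_comp e).
have iso_t a : rep_iso (chi a) (chord_module k (c (t a))) by rewrite -{1}[a]tK; apply: iso.
have [beta' eb'] := ext_basis_transport eb iso_t.
have Rrefl : reflexive R by move=> a; apply: arrow_rel_refl.
have Rrank : exists rk : 'I_n -> nat, forall i j, R i j -> i != j -> (rk i < rk j)%N.
  exists (fun a => val (t a)) => i j ij nij.
  by apply: (arrow_rel_rank exc ij); rewrite (inj_eq perm_inj).
have Rchain i j l m : R i j -> R i l -> R l j -> R i m -> R m j -> R l m || R m l.
  exact: arrow_rel_chain.
split=> //; last first.
- by move=> G; apply: (hom_ext_quiver_presented eb').
- exact: (ext_basis_local_order eb').
apply/setP=> e; rewrite inE; apply/asboolP/imsetP.
  move=> [i [j [lt_ij -> [a iso_a]]]]; exists (t a) => //.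
  have -> // : c (t a) = (i, j).
  apply: (@interval_iso_inj k n) => //; first exact: interval_lt.
  by apply: rep_iso_trans iso_a; apply: rep_iso_sym.
move=> [a _ ->]; exists (c a).1, (c a).2; split=> //; first exact: interval_lt.
by exists (s a).
Qed.

Theorem theorem4p1 (k : closedFieldType) (n : nat) (n_ge2 : (2 <= n)%N)
    (chi chi' : 'I_n -> rep k (linear_quiver n))
    (chi_complete : complete_exceptional_collection chi)
    (chi'_complete : complete_exceptional_collection chi')
    (G G' : bound_quiver k 'I_n)
    (G_chi : hom_ext_quiver chi G)
    (G'_chi' : hom_ext_quiver chi' G') :
  bound_quiver_iso G G' <->
  exists m : nat, tree chi' = iter m (@rotation n) (tree chi).
Proof.
have [s [c [exc -> loR /(_ _ G_chi) prG]]] := collection_presented chi_complete.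
have [s' [c' [exc' -> loR' /(_ _ G'_chi') prG']]] := collection_presented chi'_complete.
split=> [iso|[m eqT]].
  have [phi phi_inj phiR] := bound_iso_rel loR loR' prG prG' iso.
  apply: (recover_rotation exc exc' n_ge2 (phi := fun a => (s'^-1)%g (phi (s a)))).
    by move=> a b /perm_inj/phi_inj/perm_inj.
  by move=> a b; rewrite -phiR !permK.
have [phi phi_inj phiR] := rotated_trees exc exc' eqT.
apply: (rel_bound_iso prG prG' (phi := fun a => s' (phi ((s^-1)%g a)))).
  by move=> a b /perm_inj/phi_inj/perm_inj.
by move=> a b; rewrite !permK phiR.
Qed.
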